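(* Work either in $\mathsf{CZF}+\mathsf{DCom}+\Sigma\text{-}\mathsf{Sep}$ or in $\mathsf{CZF}+\mathsf{DCom}+\mathsf{REA}$. Let $\mathcal{A}$ be a partial combinatory algebra (pca). Then $V(\mathcal{A})\models\mathsf{DCom}$.
   Context: The logic is intuitionistic. $\mathsf{CZF}$ has axioms Extensionality, Pairing, Union, Infinity, the $\in$-Induction scheme, $\Delta_0$-Separation, Strong Collection (if $\forall x\in a\,\exists y\,\phi(x,y)$ then there is a set $b$ with $\forall x\in a\,\exists y\in b\,\phi(x,y)$ and $\forall y\in b\,\exists x\in a\,\phi(x,y)$), and Subset Collection (for all sets $a,b$ there is a set $c$ such that for all $u$, if $\forall x\in a\,\exists y\in b\,\phi(x,y,u)$ then there is $d\in c$ with $\forall x\in a\,\exists y\in d\,\phi(x,y,u)$ and $\forall y\in d\,\exists x\in a\,\phi(x,y,u)$). $\mathsf{DCom}$: $\forall x\,\exists y\,\forall z\,(\neg\neg(z\in x)\to z\in y)$. $\Sigma\text{-}\mathsf{Sep}$ is Separation for $\Sigma$-formulas. $\mathsf{REA}$ (Regular Extension Axiom): every set is a subset of a regular set, where a set $B$ is regular if it is inhabited, transitive, and for every $a\in B$ and every set $R\subseteq a\times B$ with $\forall x\in a\,\exists y\,\langle x,y\rangle\in R$ there is $b\in B$ with $\forall x\in a\,\exists y\in b\,\langle x,y\rangle\in R$ and $\forall y\in b\,\exists x\in a\,\langle x,y\rangle\in R$. McCarty-style realizability: the pca $\mathcal{A}$ is a set, with application written by juxtaposition, with pairing combinator $\mathbf{p}$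 and projections $(e)_0,(e)_1$, and with numerals $\mathbf{0},\mathbf{1}\in\mathcal{A}$. The class $V(\mathcal{A})=\bigcup_{\alpha\in\mathrm{Ord}}V(\mathcal{A})_\alpha$, where $V(\mathcal{A})_\alpha=\bigcup_{\beta\in\alpha}\mathcal{P}(\mathcal{A}\times V(\mathcal{A})_\beta)$. For $e\in\mathcal{A}$ and parameters in $V(\mathcal{A})$ (application terms are required to be defined): $e\Vdash a\in b$ iff there is $c$ with $\langle(e)_0,c\rangle\in b$ and $(e)_1\Vdash a=c$; $e\Vdash a=b$ iff for all $f,d$: $\langle f,d\rangle\in a$ implies $(e)_0f\Vdash d\in b$, and $\langle f,d\rangle\in b$ implies $(e)_1f\Vdash d\in a$; $e\Vdash\phi\land\psi$ iff $(e)_0\Vdash\phi$ and $(e)_1\Vdash\psi$; $e\Vdash\phi\lor\psi$ iff ($(e)_0=\mathbf{0}$ and $(e)_1\Vdash\phi$) or ($(e)_0=\mathbf{1}$ and $(e)_1\Vdash\psi$); $e\Vdash\neg\phi$ iff no $f\in\mathcal{A}$ satisfies $f\Vdash\phi$; $e\Vdash\phi\to\psi$ iff for all $f\in\mathcal{A}$, $f\Vdash\phi$ implies $ef\Vdash\psi$; $e\Vdash\forall x\in a\,\phi(x)$ iff for all $\langle f,c\rangle\in a$, $ef\Vdash\phi(c)$; $e\Vdash\exists x\in a\,\phi(x)$ iff there is $c$ with $\langle(e)_0,c\rangle\in a$ and $(e)_1\Vdash\phi(c)$; $e\Vdash\forall x\,\phi(x)$ iff $e\Vdash\phi(c)$ for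 all $c\in V(\mathcal{A})$; $e\Vdash\exists x\,\phi(x)$ iff $e\Vdash\phi(c)$ for some $c\in V(\mathcal{A})$. $V(\mathcal{A})\models\phi$ means that some $e\in\mathcal{A}$ satisfies $e\Vdash\phi$. *)

(* Defs.v *)
(* CZF as a theory of intuitionistic first-order logic, with derivability
   defined by natural deduction, and McCarty realizability over a partial
   combinatory algebra as a translation of set-theoretic formulas.  "CZF + ...
   proves ..." is syntactic derivability, so the logic of the object theory is
   intuitionistic whatever axioms are assumed in Rocq. *)

From Stdlib Require Import List.
Import ListNotations.

(** * Formulas and derivations *)

(* The language of set theory, with de Bruijn indices.  It has no function
   symbols, so terms are variables.  The first argument of [BAll] and [BEx] is
   the bounding set, which lies outside the scope of the quantifier. *)
Inductive form : Type :=
| Mem (i j : nat)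
| Eq (i j : nat)
| And (p q : form)
| Or (p q : form)
| Neg (p : form)
| Imp (p q : form)
| BAll (i : nat) (p : form)
| BEx (i : nat) (p : form)
| All (p : form)
| Ex (p : form).

Definition scons {X : Type} (x : X) (r : nat -> X) (i : nat) : X :=
  match i with 0 => x | S j => r j end.

Definition up (r : nat -> nat) : nat -> nat := scons 0 (fun i => S (r i)).

Fixpoint ren (r : nat -> nat) (p : form) : form :=
  match p with
  | Mem i j => Mem (r i) (r j)
  | Eq i j => Eq (r i) (r j)
  | And p q => And (ren r p) (ren r q)
  | Or p q => Or (ren r p) (ren r q)
  | Neg p => Neg (ren r p)
  | Imp p q => Imp (ren r p) (ren r q)
  | BAll i p => BAll (r i) (ren (up r) p)
  | BEx i p => BEx (r i) (ren (up r) p)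
  | All p => All (ren (up r) p)
  | Ex p => Ex (ren (up r) p)
  end.

Definition shift : form -> form := ren S.

Definition inst (x : nat) : form -> form := ren (scons x (fun i => i)).

Definition theory := form -> Prop.

(* Axioms are not shifted when a quantifier is introduced: their free variables
   are implicitly universally quantified. *)
Inductive nd (T : theory) : list form -> form -> Prop :=
| nd_axiom G p : T p -> nd T G p
| nd_hyp G p : In p G -> nd T G p
| nd_andI G p q : nd T G p -> nd T G q -> nd T G (And p q)
| nd_andE1 G p q : nd T G (And p q) -> nd T G p
| nd_andE2 G p q : nd T G (And p q) -> nd T G q
| nd_orI1 G p q : nd T G p -> nd T G (Or p q)
| nd_orI2 G p q : nd T G q -> nd T G (Or p q)
| nd_orE G p q r :
    nd T G (Or p q) -> nd T (p :: G) r -> nd T (q :: G) r -> nd T G r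
| nd_negI G p q : nd T (p :: G) q -> nd T (p :: G) (Neg q) -> nd T G (Neg p)
| nd_negE G p q : nd T G p -> nd T G (Neg p) -> nd T G q
| nd_impI G p q : nd T (p :: G) q -> nd T G (Imp p q)
| nd_impE G p q : nd T G (Imp p q) -> nd T G p -> nd T G q
| nd_ballI G a p :
    nd T (Mem 0 (S a) :: map shift G) p -> nd T G (BAll a p)
| nd_ballE G a p x : nd T G (BAll a p) -> nd T G (Mem x a) -> nd T G (inst x p)
| nd_bexI G a p x : nd T G (Mem x a) -> nd T G (inst x p) -> nd T G (BEx a p)
| nd_bexE G a p q :
    nd T G (BEx a p) -> nd T (p :: Mem 0 (S a) :: map shift G) (shift q) ->
    nd T G q
| nd_allI G p : nd T (map shift G) p -> nd T G (All p)
| nd_allE G p x : nd T G (All p) -> nd T G (inst x p)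
| nd_exI G p x : nd T G (inst x p) -> nd T G (Ex p)
| nd_exE G p q :
    nd T G (Ex p) -> nd T (p :: map shift G) (shift q) -> nd T G q
| nd_eqI G x : nd T G (Eq x x)
| nd_eqE G p x y : nd T G (Eq x y) -> nd T G (inst x p) -> nd T G (inst y p).

Definition proves (T : theory) (p : form) : Prop := nd T [] p.

Definition theory_union (T U : theory) : theory := fun p => T p \/ U p.

Definition axiom (p : form) : theory := fun q => q = p.

(** * Formulas with named binders *)

(* A formula under construction takes the number [n] of enclosing binders.  A
   bound variable is named by its level, the number of binders enclosing the
   one that introduces it; under [n] binders, level [x] is index [n - S x]. *)
Definition var := nat.
Definition fml := nat -> form.

Definition index (n : nat) (x : var) : nat := n - S x.

Definition fMem (x y : var) : fml := fun n => Mem (index n x) (index n y).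
Definition fEq (x y : var) : fml := fun n => Eq (index n x) (index n y).
Definition fAnd (p q : fml) : fml := fun n => And (p n) (q n).
Definition fOr (p q : fml) : fml := fun n => Or (p n) (q n).
Definition fNeg (p : fml) : fml := fun n => Neg (p n).
Definition fImp (p q : fml) : fml := fun n => Imp (p n) (q n).
Definition fIff (p q : fml) : fml := fAnd (fImp p q) (fImp q p).
Definition fBAll (a : var) (p : var -> fml) : fml :=
  fun n => BAll (index n a) (p n (S n)).
Definition fBEx (a : var) (p : var -> fml) : fml :=
  fun n => BEx (index n a) (p n (S n)).
Definition fAll (p : var -> fml) : fml := fun n => All (p n (S n)).
Definition fEx (p : var -> fml) : fml := fun n => Ex (p n (S n)).

(* [plug p [x0; ...; xk]] is [p] with its indices 0, ..., k read as x0, ..., xk.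
   Its other indices are parameters: they become free variables of the whole
   formula, hence cannot be captured. *)
Definition plug (p : form) (xs : list var) : fml := fun n =>
  ren (fun i => match nth_error xs i with
                | Some x => index n x
                | None => n + (i - length xs)
                end) p.

Definition close (p : fml) : form := p 0.

Declare Scope fml_scope.
Delimit Scope fml_scope with fml.
Bind Scope fml_scope with fml.
Local Open Scope fml_scope.

Notation "x ∈ y" := (fMem x y) (at level 70, no associativity) : fml_scope.
Notation "x ≐ y" := (fEq x y) (at level 70, no associativity) : fml_scope.
Notation "¬ p" := (fNeg p) (at level 75, right associativity) : fml_scope.
Notation "p ∧ q" := (fAnd p q) (at level 80, right associativity) : fml_scope.
Notation "p ∨ q" := (fOr p q) (at level 85, right associativity) : fml_scope.
Notation "p ⟶ q" := (fImp p q) (at level 99, right associativity) : fml_scope.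
Notation "p ⟷ q" := (fIff p q) (at level 95, no associativity) : fml_scope.
Notation "∀ x , p" := (fAll (fun x => p))
  (at level 200, x name, p at level 200, right associativity) : fml_scope.
Notation "∃ x , p" := (fEx (fun x => p))
  (at level 200, x name, p at level 200, right associativity) : fml_scope.
Notation "∀ x ∈ a , p" := (fBAll a (fun x => p))
  (at level 200, x name, a at level 69, p at level 200, right associativity)
  : fml_scope.
Notation "∃ x ∈ a , p" := (fBEx a (fun x => p))
  (at level 200, x name, a at level 69, p at level 200, right associativity)
  : fml_scope.

(** * Set-theoretic vocabulary *)

Definition is_empty (x : var) : fml := ∀ y, ¬ (y ∈ x).

Definition is_succ (x y : var) : fml := ∀ z, z ∈ x ⟷ (z ∈ y ∨ z ≐ y).

Definition is_upair (z x y : var) : fml :=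
  x ∈ z ∧ y ∈ z ∧ ∀ t ∈ z, t ≐ x ∨ t ≐ y.

(* [z] is the Kuratowski pair <x, y> *)
Definition is_pair (z x y : var) : fml :=
  (∃ u ∈ z, is_upair u x x) ∧ (∃ v ∈ z, is_upair v x y) ∧
  ∀ w ∈ z, is_upair w x x ∨ is_upair w x y.

(* [t] is <<x, y>, z>; the pair <x, y> belongs to an element of [t], so it can
   be quantified over with bounds *)
Definition is_triple (t x y z : var) : fml :=
  ∃ u ∈ t, ∃ q ∈ u, is_pair q x y ∧ is_pair t q z.

Definition pair_in (x y a : var) : fml := ∃ z ∈ a, is_pair z x y.

Definition triple_in (x y z a : var) : fml := ∃ t ∈ a, is_triple t x y z.

Definition is_transitive (a : var) : fml := ∀ x ∈ a, ∀ y ∈ x, y ∈ a.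

Definition is_ord (a : var) : fml :=
  is_transitive a ∧ ∀ x ∈ a, is_transitive x.

(** * Axioms *)

Inductive Delta0 : form -> Prop :=
| Delta0_mem i j : Delta0 (Mem i j)
| Delta0_eq i j : Delta0 (Eq i j)
| Delta0_and p q : Delta0 p -> Delta0 q -> Delta0 (And p q)
| Delta0_or p q : Delta0 p -> Delta0 q -> Delta0 (Or p q)
| Delta0_neg p : Delta0 p -> Delta0 (Neg p)
| Delta0_imp p q : Delta0 p -> Delta0 q -> Delta0 (Imp p q)
| Delta0_ball i p : Delta0 p -> Delta0 (BAll i p)
| Delta0_bex i p : Delta0 p -> Delta0 (BEx i p).

Inductive Sigma : form -> Prop :=
| Sigma_Delta0 p : Delta0 p -> Sigma p
| Sigma_and p q : Sigma p -> Sigma q -> Sigma (And p q)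
| Sigma_or p q : Sigma p -> Sigma q -> Sigma (Or p q)
| Sigma_ball i p : Sigma p -> Sigma (BAll i p)
| Sigma_bex i p : Sigma p -> Sigma (BEx i p)
| Sigma_ex p : Sigma p -> Sigma (Ex p).

Definition extensionality : form := close
  (∀ a, ∀ b, (∀ x, x ∈ a ⟷ x ∈ b) ⟶ a ≐ b).

Definition pairing : form := close
  (∀ a, ∀ b, ∃ c, ∀ x, x ∈ c ⟷ (x ≐ a ∨ x ≐ b)).

Definition union : form := close
  (∀ a, ∃ c, ∀ x, x ∈ c ⟷ (∃ y ∈ a, x ∈ y)).

Definition infinity : form := close
  (∃ w, ∀ x, x ∈ w ⟷ (is_empty x ∨ ∃ y ∈ w, is_succ x y)).

Definition set_induction (p : form) : form := close
  ((∀ x, (∀ y ∈ x, plug p [y]) ⟶ plug p [x]) ⟶ ∀ x, plug p [x]).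

Definition separation (p : form) : form := close
  (∀ a, ∃ b, ∀ x, x ∈ b ⟷ (x ∈ a ∧ plug p [x])).

Definition strong_collection (p : form) : form := close
  (∀ a, (∀ x ∈ a, ∃ y, plug p [x; y]) ⟶
     ∃ b, (∀ x ∈ a, ∃ y ∈ b, plug p [x; y]) ∧
          (∀ y ∈ b, ∃ x ∈ a, plug p [x; y])).

Definition subset_collection (p : form) : form := close
  (∀ a, ∀ b, ∃ c, ∀ u, (∀ x ∈ a, ∃ y ∈ b, plug p [x; y; u]) ⟶
     ∃ d ∈ c, (∀ x ∈ a, ∃ y ∈ d, plug p [x; y; u]) ∧
              (∀ y ∈ d, ∃ x ∈ a, plug p [x; y; u])).

Inductive CZF : theory :=
| CZF_extensionality : CZF extensionality
| CZF_pairing : CZF pairing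
| CZF_union : CZF union
| CZF_infinity : CZF infinity
| CZF_set_induction p : CZF (set_induction p)
| CZF_Delta0_separation p : Delta0 p -> CZF (separation p)
| CZF_strong_collection p : CZF (strong_collection p)
| CZF_subset_collection p : CZF (subset_collection p).

Definition DCom : form := close
  (∀ x, ∃ y, ∀ z, ¬ ¬ (z ∈ x) ⟶ z ∈ y).

Inductive Sigma_Sep : theory :=
| Sigma_Sep_separation p : Sigma p -> Sigma_Sep (separation p).

Definition is_regular (B : var) : fml :=
  (∃ x, x ∈ B) ∧ is_transitive B ∧
  ∀ a ∈ B, ∀ R,
    (∀ t ∈ R, ∃ x ∈ a, ∃ y ∈ B, is_pair t x y) ⟶
    (∀ x ∈ a, ∃ y, pair_in x y R) ⟶
    ∃ b ∈ B, (∀ x ∈ a, ∃ y ∈ b, pair_in x y R) ∧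
             (∀ y ∈ b, ∃ x ∈ a, pair_in x y R).

Definition REA : form := close
  (∀ a, ∃ B, is_regular B ∧ ∀ x ∈ a, x ∈ B).

(** * Partial combinatory algebras *)

(* The variables standing for a pca in the object language: its underlying set,
   its application (the set of <<e, f>, g> such that e f is defined and equal
   to g), the pairing combinator with the elements that represent (e)_0 and
   (e)_1, and the numerals 0 and 1. *)
Record pca_vars : Type := PcaVars {
  carrier : var;
  appl : var;
  pr : var;
  pr0 : var;
  pr1 : var;
  num0 : var;
  num1 : var
}.

Definition app_eq (P : pca_vars) (x y z : var) : fml := triple_in x y z (appl P).

(* the application x y is defined, and its value satisfies [p] *)
Definition app_sat (P : pca_vars) (x y : var) (p : var -> fml) : fml :=
  ∃ z ∈ carrier P, app_eq P x y z ∧ p z.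

Definition is_partial_app (P : pca_vars) : fml :=
  let A := carrier P in
  (∀ t ∈ appl P, ∃ x ∈ A, ∃ y ∈ A, ∃ z ∈ A, is_triple t x y z) ∧
  (∀ x ∈ A, ∀ y ∈ A, ∀ z ∈ A, ∀ w ∈ A,
     app_eq P x y z ∧ app_eq P x y w ⟶ z ≐ w).

(* k x y = x *)
Definition is_k (P : pca_vars) (k : var) : fml :=
  let A := carrier P in
  ∀ x ∈ A, ∀ y ∈ A, app_sat P k x (fun kx => app_eq P kx y x).

(* s x y is defined, and s x y z is defined if and only if x z (y z) is, in
   which case they are equal *)
Definition is_s (P : pca_vars) (s : var) : fml :=
  let A := carrier P in
  ∀ x ∈ A, ∀ y ∈ A,
    app_sat P s x (fun sx => app_sat P sx y (fun sxy =>
      ∀ z ∈ A, ∀ w ∈ A,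
        app_eq P sxy z w ⟷
        app_sat P x z (fun xz => app_sat P y z (fun yz => app_eq P xz yz w)))).

(* (p x y)_0 = x and (p x y)_1 = y *)
Definition is_pairing (P : pca_vars) : fml :=
  let A := carrier P in
  pr P ∈ A ∧ pr0 P ∈ A ∧ pr1 P ∈ A ∧
  ∀ x ∈ A, ∀ y ∈ A,
    app_sat P (pr P) x (fun px => app_sat P px y (fun pxy =>
      app_eq P (pr0 P) pxy x ∧ app_eq P (pr1 P) pxy y)).

(* some d satisfies d 0 x y = x and d 1 x y = y *)
Definition is_numerals (P : pca_vars) : fml :=
  let A := carrier P in
  num0 P ∈ A ∧ num1 P ∈ A ∧
  ∃ d ∈ A, ∀ x ∈ A, ∀ y ∈ A,
    app_sat P d (num0 P) (fun e => app_sat P e x (fun f => app_eq P f y x)) ∧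
    app_sat P d (num1 P) (fun e => app_sat P e x (fun f => app_eq P f y y)).

Definition is_pca (P : pca_vars) : fml :=
  is_partial_app P ∧
  (∃ k ∈ carrier P, is_k P k) ∧ (∃ s ∈ carrier P, is_s P s) ∧
  is_pairing P ∧ is_numerals P.

(** * Realizability *)

(* x ∈ V(A)_α.  The stages V(A)_α are proper classes, so the recursion
   V(A)_α = ⋃_{β ∈ α} P(A × V(A)_β) cannot be carried by a function with set
   values.  Instead, the derivation of x ∈ V(A)_α is a set W of pairs <y, β>,
   each satisfying the recursion clause relative to W. *)
Definition in_stage (P : pca_vars) (x alpha : var) : fml :=
  ∃ W, pair_in x alpha W ∧
    ∀ y, ∀ beta, pair_in y beta W ⟶
      ∃ gamma ∈ beta, ∀ z ∈ y, ∃ f ∈ carrier P, ∃ u,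
        is_pair z f u ∧ pair_in u gamma W.

Definition in_VA (P : pca_vars) (x : var) : fml :=
  ∃ alpha, is_ord alpha ∧ in_stage P x alpha.

(* e ⊩ a ∈ b, where [req e a c] stands for e ⊩ a = c *)
Definition mem_clause (P : pca_vars) (req : var -> var -> var -> fml)
    (e a b : var) : fml :=
  ∃ c, app_sat P (pr0 P) e (fun e0 => pair_in e0 c b) ∧
       app_sat P (pr1 P) e (fun e1 => req e1 a c).

(* e ⊩ a = b, in terms of the same relation [req] *)
Definition eq_clause (P : pca_vars) (req : var -> var -> var -> fml)
    (e a b : var) : fml :=
  ∀ f, ∀ d,
    (pair_in f d a ⟶
       app_sat P (pr0 P) e (fun e0 => app_sat P e0 f (fun g =>
         mem_clause P req g d b))) ∧
    (pair_in f d b ⟶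
       app_sat P (pr1 P) e (fun e1 => app_sat P e1 f (fun g =>
         mem_clause P req g d a))).

(* The recursive definition of e ⊩ a = b.  As for [in_stage], <<e, a>, b>
   belongs to a set R of triples each satisfying the clause relative to R; by
   ∈-induction the clause has a unique solution, which is the union of the sets
   R. *)
Definition realizes_eq (P : pca_vars) (e a b : var) : fml :=
  ∃ R, triple_in e a b R ∧
    ∀ e', ∀ a', ∀ b', triple_in e' a' b' R ⟶
      eq_clause P (fun x y z => triple_in x y z R) e' a' b'.

Definition realizes_mem (P : pca_vars) (e a b : var) : fml :=
  mem_clause P (realizes_eq P) e a b.

(* e ⊩ p, where [r] assigns variables to the indices of [p] *)
Fixpoint realizes (P : pca_vars) (e : var) (r : nat -> var) (p : form) : fml :=
  let A := carrier P in
  match p with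
  | Mem i j => realizes_mem P e (r i) (r j)
  | Eq i j => realizes_eq P e (r i) (r j)
  | And p q =>
      app_sat P (pr0 P) e (fun e0 => realizes P e0 r p) ∧
      app_sat P (pr1 P) e (fun e1 => realizes P e1 r q)
  | Or p q =>
      (app_eq P (pr0 P) e (num0 P) ∧
       app_sat P (pr1 P) e (fun e1 => realizes P e1 r p)) ∨
      (app_eq P (pr0 P) e (num1 P) ∧
       app_sat P (pr1 P) e (fun e1 => realizes P e1 r q))
  | Neg p => ¬ (∃ f ∈ A, realizes P f r p)
  | Imp p q =>
      ∀ f ∈ A, realizes P f r p ⟶ app_sat P e f (fun g => realizes P g r q)
  | BAll i p =>
      ∀ f, ∀ c, pair_in f c (r i) ⟶
        app_sat P e f (fun g => realizes P g (scons c r) p)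
  | BEx i p =>
      ∃ c, app_sat P (pr0 P) e (fun e0 => pair_in e0 c (r i)) ∧
           app_sat P (pr1 P) e (fun e1 => realizes P e1 (scons c r) p)
  | All p => ∀ c, in_VA P c ⟶ realizes P e (scons c r) p
  | Ex p => ∃ c, in_VA P c ∧ realizes P e (scons c r) p
  end.

(* V(A) ⊨ p, for a sentence p: the value of the assignment is irrelevant *)
Definition VA_models (P : pca_vars) (p : form) : fml :=
  ∃ e ∈ carrier P, realizes P e (fun _ => 0) p.

Definition every_pca_models (p : form) : form := close
  (∀ A, ∀ ap, ∀ pair, ∀ fst, ∀ snd, ∀ n0, ∀ n1,
     let P := PcaVars A ap pair fst snd n0 n1 in
     is_pca P ⟶ VA_models P p).

(* Main.v *)
From Stdlib Require Import List PeanoNat Lia FunctionalExtensionality.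
Require Import Defs.
Import ListNotations.

(** Why the theorem holds.  The argument takes place in [CZF] with [DCom], which
    both theories contain.

    [DCom] makes powersets available.  If every element of [z] equals [x], it is
    absurd that [z] differs from both the empty set and [{x}], so [DCom], applied
    to [{∅, {x}}], puts all subsets of [{x}] into one set.  Subset Collection,
    applied to the graphs of [x ↦ {x | x ∈ u}], then puts all subsets [u] of a
    given set into one set ([cover_powerset]).

    For [c] in the realizability universe, the [z] in the universe with some
    [e ⊩ z = c] form a class that a set covers ([cover_realizably_equal]): each
    element of [z] is a pair [<g, u>] with [g] in the pca and [u] realizably equal
    to some [c'] occurring in [c], so by ∈-induction [u] ranges over a set [U],
    and [z] is a subset of [A × U].  Hence a set [U] covers the [z] for which
    [z ∈ x] is realized, and [DCom] applied to [U] gives a set [Y] of all [z] for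
    which it is not absurd that [z ∈ x] is realized ([cover_not_not_elements]).
    The set required by [DCom] in the universe is [y = {<0, z> | z ∈ Y}], with [z]
    restricted to the universe; the restriction is a set because each statement
    that [z] is in the universe has, by induction, a truth value that is a set
    ([VA_separation]).  As
    [z] itself occurs in [y], [z ∈ y] is realized by [p 0 i] for an [i] that
    realizes [z = z] for every [z]; a fixed point of the pca provides it
    ([Reflexive_ex]), and the constant function with value [p 0 i] realizes
    [DCom].

    Derivations are built semantically.  A proposition is a set of contexts, the
    connectives are interpreted as in a Kripke or Beth model over the contexts,
    and such a model forces a formula at a context exactly if the formula is
    derivable there ([sem_derives]).  Individuals are the names of the free
    variables, so quantifiers become quantifiers of the metatheory, and an implication
    between statements forced at a variable context is what a derived rule says. *)

(** * Renaming and weakening of derivations *)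

Lemma up_comp f g i : up f (up g i) = up (fun j => f (g j)) i.
Proof. destruct i; reflexivity. Qed.

Lemma ren_ren f g p : ren f (ren g p) = ren (fun i => f (g i)) p.
Proof.
  revert f g; induction p; intros f g; cbn; rewrite ?IHp, ?IHp1, ?IHp2;
    try reflexivity; f_equal; f_equal; extensionality n; apply up_comp.
Qed.

Lemma up_id : up (fun i => i) = fun i => i.
Proof. extensionality i; destruct i; reflexivity. Qed.

Lemma ren_id p : ren (fun i => i) p = p.
Proof. induction p; cbn; rewrite ?up_id; congruence. Qed.

Lemma ren_inst f x p : ren f (inst x p) = inst (f x) (ren (up f) p).
Proof.
  unfold inst; rewrite !ren_ren; f_equal.
  extensionality i; destruct i; reflexivity.
Qed.

Lemma ren_shift f p : ren (up f) (shift p) = shift (ren f p).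
Proof. unfold shift; rewrite !ren_ren; reflexivity. Qed.

Lemma map_ren_shift f G :
  map (ren (up f)) (map shift G) = map shift (map (ren f) G).
Proof. rewrite !map_map; apply map_ext, ren_shift. Qed.

Lemma inst_up x r p : inst x (ren (up r) p) = ren (scons x r) p.
Proof.
  unfold inst; rewrite ren_ren; f_equal.
  extensionality i; destruct i; reflexivity.
Qed.

(** Nothing is subtracted at binders, as an upper bound of the free indices is all
    that the choice of a fresh name requires. *)
Fixpoint bound (p : form) : nat :=
  match p with
  | Mem i j | Eq i j => S (i + j)
  | And p q | Or p q | Imp p q => bound p + bound q
  | Neg p | All p | Ex p => bound p
  | BAll i p | BEx i p => S i + bound p
  end.

Lemma ren_ext_bound p f g :
  (forall i, i < bound p -> f i = g i) -> ren f p = ren g p.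
Proof.
  revert f g; induction p; cbn; intros f g E; f_equal;
    try (apply E; lia);
    match goal with
    | IH : forall f g, _ -> ren f ?q = ren g ?q |- ren _ ?q = ren _ ?q =>
        apply IH; intros [|k] Hk; cbn
    end; try reflexivity; try (rewrite E by lia; reflexivity);
    apply E; lia.
Qed.

Fixpoint bounds (G : list form) : nat :=
  match G with [] => 0 | p :: G => bound p + bounds G end.

(** Turns a fresh name [x] into the variable that a binder introduces: the rules
    for quantifiers can then be stated with names instead of shifts. *)
Definition abstract (x : nat) (i : nat) : nat :=
  if Nat.eqb i x then 0 else S i.

Lemma abstract_fresh x p : bound p <= x -> ren (abstract x) p = shift p.
Proof.
  intros Hx; apply ren_ext_bound; intros i Hi; unfold abstract.
  destruct (Nat.eqb_spec i x); [lia | reflexivity].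
Qed.

Lemma abstract_fresh_ctx x G :
  bounds G <= x -> map (ren (abstract x)) G = map shift G.
Proof.
  induction G as [|p G IH]; cbn; intros Hx; [reflexivity|].
  rewrite abstract_fresh, IH by lia; reflexivity.
Qed.

Lemma abstract_inst x p : bound p <= x -> ren (abstract x) (inst x p) = p.
Proof.
  intros Hx; unfold inst; rewrite ren_ren.
  rewrite <- (ren_id p) at 2.
  apply ren_ext_bound; intros [|i] Hi; unfold abstract; cbn.
  - now rewrite Nat.eqb_refl.
  - destruct (Nat.eqb_spec i x); [lia | reflexivity].
Qed.

Lemma incl_cons2 (p : form) G H : incl G H -> incl (p :: G) (p :: H).
Proof. intros L q [E|I]; [left | right; apply L]; assumption. Qed.

Lemma nd_weaken (T U : theory) G H p :
  (forall q, T q -> U q) -> nd T G p -> incl G H -> nd U H p.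
Proof.
  intros TU D; revert H; induction D; intros H' L;
    [ eapply nd_axiom | eapply nd_hyp | eapply nd_andI | eapply nd_andE1
    | eapply nd_andE2 | eapply nd_orI1 | eapply nd_orI2 | eapply nd_orE
    | eapply (nd_negI _ _ _ q) | eapply (nd_negE _ _ p) | eapply nd_impI
    | eapply nd_impE | eapply nd_ballI | eapply nd_ballE | eapply nd_bexI
    | eapply nd_bexE | eapply nd_allI | eapply nd_allE | eapply nd_exI
    | eapply nd_exE | eapply nd_eqI | eapply nd_eqE ];
    eauto using incl_cons2, incl_map.
Qed.

(** Axioms are not shifted under quantifiers, so renaming a derivation renames the
    parameters of its axioms. *)
Lemma nd_ren (T : theory) :
  (forall f p, T p -> T (ren f p)) ->
  forall G p, nd T G p -> forall f, nd T (map (ren f) G) (ren f p).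
Proof.
  intros Tren G p D; induction D; intros g; cbn in *; rewrite ?ren_inst.
  - apply nd_axiom; auto.
  - apply nd_hyp, in_map; assumption.
  - apply nd_andI; auto.
  - eapply nd_andE1, IHD.
  - eapply nd_andE2, IHD.
  - apply nd_orI1; auto.
  - apply nd_orI2; auto.
  - eapply nd_orE; eauto.
  - eapply nd_negI; eauto.
  - eapply nd_negE; eauto.
  - apply nd_impI; auto.
  - eapply nd_impE; eauto.
  - apply nd_ballI; rewrite <- map_ren_shift; apply (IHD (up g)).
  - eapply nd_ballE; eauto.
  - apply nd_bexI with (g x); auto. rewrite <- ren_inst; auto.
  - eapply nd_bexE; [apply IHD1|].
    rewrite <- map_ren_shift, <- ren_shift; apply (IHD2 (up g)).
  - apply nd_allI; rewrite <- map_ren_shift; auto.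
  - apply nd_allE; auto.
  - apply nd_exI with (g x); rewrite <- ren_inst; auto.
  - eapply nd_exE; [apply IHD1|].
    rewrite <- map_ren_shift, <- ren_shift; apply (IHD2 (up g)).
  - apply nd_eqI.
  - eapply nd_eqE; [apply IHD1|]. rewrite <- ren_inst; auto.
Qed.

(** What the two theories of the theorem have in common. *)
Definition CZF_DCom : theory := theory_union CZF (axiom DCom).

Lemma ren_Delta0 f p : Delta0 p -> Delta0 (ren f p).
Proof. intros D; revert f; induction D; intros f; cbn; constructor; auto. Qed.

(** [ups k f] is [f] under [k] binders.  The parameters of a scheme are the indices
    above those of its displayed variables, so renaming an instance of a scheme
    renames its formula under as many binders. *)
Fixpoint ups (k : nat) (f : nat -> nat) : nat -> nat :=
  match k with 0 => f | S k => up (ups k f) end.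

Lemma ups_lt k f i : i < k -> ups k f i = i.
Proof.
  revert i; induction k; intros [|i] Hi; cbn; try lia.
  rewrite IHk; lia.
Qed.

Lemma ups_add k f i : ups k f (k + i) = k + f i.
Proof. induction k; cbn; congruence. Qed.

Lemma ren_plug f p xs n :
  Forall (fun x => x < n) xs ->
  ren (ups n f) (plug p xs n) = plug (ren (ups (length xs) f) p) xs n.
Proof.
  intros Hxs; unfold plug, var in *; rewrite !ren_ren; f_equal.
  extensionality i.
  destruct (nth_error xs i) as [x|] eqn:E.
  - rewrite (ups_lt (length xs)), E by (apply nth_error_Some; congruence).
    apply ups_lt; unfold index.
    rewrite Forall_forall in Hxs; apply nth_error_In, Hxs in E; lia.
  - apply nth_error_None in E.
    destruct (Nat.le_exists_sub _ _ E) as (k & -> & _).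
    rewrite (Nat.add_comm k), !ups_add, (proj2 (nth_error_None _ _)) by lia.
    replace (length xs + k - length xs) with k by lia; lia.
Qed.

Ltac ren_schema f :=
  cbv -[plug ren up ups]; cbn -[plug]; repeat f_equal;
  match goal with
  | |- ren _ (plug ?p ?xs ?n) = _ => apply (ren_plug f p xs n)
  end; repeat constructor.

Lemma ren_set_induction f p :
  ren f (set_induction p) = set_induction (ren (ups 1 f) p).
Proof. unfold set_induction; ren_schema f. Qed.

Lemma ren_separation f p :
  ren f (separation p) = separation (ren (ups 1 f) p).
Proof. unfold separation; ren_schema f. Qed.

Lemma ren_strong_collection f p :
  ren f (strong_collection p) = strong_collection (ren (ups 2 f) p).
Proof. unfold strong_collection; ren_schema f. Qed.

Lemma ren_subset_collection f p :
  ren f (subset_collection p) = subset_collection (ren (ups 3 f) p).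
Proof. unfold subset_collection; ren_schema f. Qed.

Lemma CZF_DCom_ren f p : CZF_DCom p -> CZF_DCom (ren f p).
Proof.
  intros [H|H].
  - left; destruct H;
      rewrite ?ren_set_induction, ?ren_separation, ?ren_strong_collection,
        ?ren_subset_collection; try (constructor; auto using ren_Delta0; fail).
  - right; hnf in *; subst; reflexivity.
Qed.

(** * Forcing over contexts *)

Definition derives : list form -> form -> Prop := nd CZF_DCom.

Lemma derives_weaken G H p : derives G p -> incl G H -> derives H p.
Proof. apply nd_weaken; trivial. Qed.

(** A proposition behaves like a formula: it persists in larger contexts, and it
    holds at [G] as soon as everything that follows from it is derivable from [G].
    The latter makes disjunction and existence elimination, which in derivations
    have a formula as their goal, available for every proposition. *)
Record prop : Type := MakeProp {
  forces : list form -> Prop;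
  forces_mono G H : forces G -> incl G H -> forces H;
  forces_local G :
    (forall C H, incl G H ->
       (forall K, incl H K -> forces K -> derives K C) -> derives H C) ->
    forces G
}.

Declare Scope prop_scope.
Delimit Scope prop_scope with prop.
Bind Scope prop_scope with prop.
Local Open Scope prop_scope.

Notation "G ⊩ p" := (forces p%prop G) (at level 98, p at level 200).

Program Definition derivable (p : form) : prop :=
  {| forces G := derives G p |}.
Next Obligation. eapply derives_weaken; eassumption. Qed.
Next Obligation. apply H; auto using incl_refl. Qed.

(** The least proposition that contains [P], if [P] persists in larger contexts. *)
Program Definition local (P : list form -> Prop) : prop :=
  {| forces G := forall C H, incl G H ->
       (forall K, incl H K -> P K -> derives K C) -> derives H C |}.
Next Obligation. eauto using incl_tran. Qed.
Next Obligation. eauto using incl_refl, incl_tran. Qed.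

Definition pMem (x y : var) : prop := derivable (Mem x y).
Definition pEq (x y : var) : prop := derivable (Eq x y).

Program Definition pAnd (p q : prop) : prop :=
  {| forces G := (G ⊩ p) /\ (G ⊩ q) |}.
Next Obligation. split; eauto using forces_mono. Qed.
Next Obligation.
  split; apply forces_local; intros C K L HC;
    apply H; auto; intros ? ? []; auto.
Qed.

Definition pOr (p q : prop) : prop := local (fun G => (G ⊩ p) \/ (G ⊩ q)).

Program Definition pImp (p q : prop) : prop :=
  {| forces G := forall H, incl G H -> (H ⊩ p) -> (H ⊩ q) |}.
Next Obligation. eauto using incl_tran. Qed.
Next Obligation.
  apply forces_local; intros C K L HC.
  apply H; [eauto using incl_tran|].
  intros K' L' Hpq. apply HC; [assumption|].
  eapply Hpq; eauto using incl_refl, forces_mono, incl_tran.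
Qed.

Program Definition pFalse : prop :=
  {| forces G := forall C, derives G C |}.
Next Obligation. eapply derives_weaken; eauto. Qed.
Next Obligation. apply H; auto using incl_refl. Qed.

Program Definition pAll (f : var -> prop) : prop :=
  {| forces G := forall x, G ⊩ f x |}.
Next Obligation. eauto using forces_mono. Qed.
Next Obligation. apply forces_local; eauto. Qed.

Definition pEx (f : var -> prop) : prop :=
  local (fun G => exists x, G ⊩ f x).

Definition pNeg (p : prop) : prop := pImp p pFalse.
Definition pIff (p q : prop) : prop := pAnd (pImp p q) (pImp q p).
Definition pBAll (a : var) (f : var -> prop) : prop :=
  pAll (fun x => pImp (pMem x a) (f x)).
Definition pBEx (a : var) (f : var -> prop) : prop :=
  pEx (fun x => pAnd (pMem x a) (f x)).

Notation "x ∈ y" := (pMem x y) (at level 70, no associativity) : prop_scope.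
Notation "x ≐ y" := (pEq x y) (at level 70, no associativity) : prop_scope.
Notation "¬ p" := (pNeg p) (at level 75, right associativity) : prop_scope.
Notation "p ∧ q" := (pAnd p q) (at level 80, right associativity) : prop_scope.
Notation "p ∨ q" := (pOr p q) (at level 85, right associativity) : prop_scope.
Notation "p ⟶ q" := (pImp p q) (at level 99, right associativity) : prop_scope.
Notation "p ⟷ q" := (pIff p q) (at level 95, no associativity) : prop_scope.
Notation "∀ x , p" := (pAll (fun x => p))
  (at level 200, x name, p at level 200, right associativity) : prop_scope.
Notation "∃ x , p" := (pEx (fun x => p))
  (at level 200, x name, p at level 200, right associativity) : prop_scope.
Notation "∀ x ∈ a , p" := (pBAll a (fun x => p))
  (at level 200, x name, a at level 69, p at level 200, right associativity)
  : prop_scope.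
Notation "∃ x ∈ a , p" := (pBEx a (fun x => p))
  (at level 200, x name, a at level 69, p at level 200, right associativity)
  : prop_scope.

(** As [sem] computes, a concrete formula is convertible to the proposition written
    with the same connectives over binders of the metatheory. *)
Fixpoint sem (p : form) (r : nat -> var) : prop :=
  match p with
  | Mem i j => r i ∈ r j
  | Eq i j => r i ≐ r j
  | And p q => sem p r ∧ sem q r
  | Or p q => sem p r ∨ sem q r
  | Neg p => ¬ sem p r
  | Imp p q => sem p r ⟶ sem q r
  | BAll i p => ∀ x ∈ r i, sem p (scons x r)
  | BEx i p => ∃ x ∈ r i, sem p (scons x r)
  | All p => ∀ x, sem p (scons x r)
  | Ex p => ∃ x, sem p (scons x r)
  end.

Lemma derives_hyp G p : derives (p :: G) p.
Proof. apply nd_hyp; left; reflexivity. Qed.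

Lemma derives_fresh x G p :
  bounds G + bound p <= x -> derives G (inst x p) -> derives (map shift G) p.
Proof.
  intros Hx D. apply (nd_ren _ CZF_DCom_ren) with (f := abstract x) in D.
  rewrite abstract_inst, abstract_fresh_ctx in D by lia. exact D.
Qed.

Lemma derives_all G p : (forall x, derives G (inst x p)) -> derives G (All p).
Proof.
  intros D. apply nd_allI. eapply derives_fresh; [constructor | apply D].
Qed.

Lemma derives_ex G p C :
  derives G (Ex p) -> (forall x, derives (inst x p :: G) C) -> derives G C.
Proof.
  intros E D. eapply nd_exE; [exact E|].
  pose (x := bounds G + bound p + bound C).
  specialize (D x).
  apply (nd_ren _ CZF_DCom_ren) with (f := abstract x) in D; cbn [map] in D.
  rewrite abstract_inst, abstract_fresh, abstract_fresh_ctx in D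
    by (subst x; lia).
  exact D.
Qed.

Lemma derives_ball G a p :
  (forall x, derives (Mem x a :: G) (inst x p)) -> derives G (BAll a p).
Proof.
  intros D. apply nd_ballI.
  pose (x := S a + bounds G + bound p).
  specialize (D x).
  apply (nd_ren _ CZF_DCom_ren) with (f := abstract x) in D; cbn [map] in D.
  rewrite abstract_inst, abstract_fresh_ctx in D by (subst x; lia).
  cbn [ren] in D; unfold abstract in D; rewrite Nat.eqb_refl in D.
  destruct (Nat.eqb_spec a x); [subst x; lia | exact D].
Qed.

Lemma derives_bex G a p C :
  derives G (BEx a p) ->
  (forall x, derives (inst x p :: Mem x a :: G) C) -> derives G C.
Proof.
  intros E D. eapply nd_bexE; [exact E|].
  pose (x := S a + bounds G + bound p + bound C).
  specialize (D x).
  apply (nd_ren _ CZF_DCom_ren) with (f := abstract x) in D; cbn [map] in D.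
  rewrite abstract_inst, abstract_fresh_ctx, (abstract_fresh x C) in D
    by (subst x; lia).
  cbn [ren] in D; unfold abstract in D; rewrite Nat.eqb_refl in D.
  destruct (Nat.eqb_spec a x); [subst x; lia | exact D].
Qed.

(** Soundness and completeness of forcing: each connective is characterized by
    its introduction and elimination rules.  For quantifiers, a derivation for
    all names contains one for a fresh name, which can be bound. *)
Lemma sem_derives p r G : (G ⊩ sem p r) <-> derives G (ren r p).
Proof.
  revert r G; induction p as
    [i j|i j|p IHp q IHq|p IHp q IHq|p IHp|p IHp q IHq|i p IHp|i p IHp
    |p IHp|p IHp]; intros r G; cbn; try reflexivity.
  - rewrite IHp, IHq; split.
    + intros []; apply nd_andI; assumption.
    + intros D; split; [eapply nd_andE1 | eapply nd_andE2]; exact D.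
  - split.
    + intros D; apply D; [apply incl_refl|]; intros K L [F|F].
      * apply nd_orI1, IHp, F.
      * apply nd_orI2, IHq, F.
    + intros D C H L F; eapply nd_orE; [eapply derives_weaken; eassumption| |];
        apply F; auto using incl_tl, incl_refl;
        [left; apply IHp | right; apply IHq]; apply derives_hyp.
  - split.
    + intros D; apply nd_negI with (ren r p); [apply derives_hyp|].
      apply D; [apply incl_tl, incl_refl|]; apply IHp, derives_hyp.
    + intros D H L F C; eapply nd_negE; [apply IHp; exact F|].
      eapply derives_weaken; eassumption.
  - split.
    + intros D; apply nd_impI, IHq, D, IHp, derives_hyp.
      apply incl_tl, incl_refl.
    + intros D H L F; apply IHq; eapply nd_impE; [|apply IHp; exact F].
      eapply derives_weaken; eassumption.
  - split.
    + intros D; apply derives_ball; intros x; rewrite inst_up.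
      apply IHp, D, derives_hyp. apply incl_tl, incl_refl.
    + intros D x H L F; apply IHp; rewrite <- inst_up.
      eapply nd_ballE; [|exact F]. eapply derives_weaken; eassumption.
  - split.
    + intros D; apply D; [apply incl_refl|]; intros K L (x & F & F').
      apply nd_bexI with x; [exact F|]. rewrite inst_up; apply IHp, F'.
    + intros D C H L F.
      eapply derives_bex; [eapply derives_weaken; eassumption|].
      intros x; apply F; [do 2 apply incl_tl; apply incl_refl|].
      exists x; split; [apply nd_hyp; right; left; reflexivity|].
      rewrite inst_up; apply IHp, derives_hyp.
  - split.
    + intros D; apply derives_all; intros x; rewrite inst_up; apply IHp, D.
    + intros D x; apply IHp; rewrite <- inst_up; apply nd_allE, D.
  - split.
    + intros D; apply D; [apply incl_refl|]; intros K L (x & F).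
      apply nd_exI with x. rewrite inst_up; apply IHp, F.
    + intros D C H L F.
      eapply derives_ex; [eapply derives_weaken; eassumption|].
      intros x; apply F; [apply incl_tl, incl_refl|].
      exists x; rewrite inst_up; apply IHp, derives_hyp.
Qed.

(** * Definable predicates and the axiom schemes *)

Lemma sem_ren f p r : sem (ren f p) r = sem p (fun i => r (f i)).
Proof.
  revert f r; induction p; intros f r; cbn;
    rewrite ?IHp1, ?IHp2, ?IHp; try reflexivity;
    f_equal; extensionality x; rewrite IHp; f_equal; extensionality j;
    destruct j; reflexivity.
Qed.

(** The environments that arise under [k] binders: the first [k] entries are the
    values of bound variables, and every name is the value of a later index. *)
Definition ends_with_names (k : nat) (r : nat -> var) : Prop :=
  forall c, r (k + c) = c.

(** [t] is a bound variable or a fixed name. *)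
Class Name (k : nat) (t : (nat -> var) -> var) : Prop :=
  name : exists i, forall r, ends_with_names k r -> t r = r i.

(** [f] is the meaning of a formula, which is bounded if [bounded] is set.  The
    axiom schemes concern formulas; instance resolution finds the formula, so
    that the schemes can be used with predicates written over binders of the metatheory. *)
Class Definable (bounded : bool) (k : nat) (f : (nat -> var) -> prop) : Prop :=
  definable : exists p, (bounded = true -> Delta0 p) /\
    forall r, ends_with_names k r -> f r = sem p r.

Instance Name_bound k i : Name k (fun r => r i) | 0.
Proof. exists i; reflexivity. Qed.

Instance Name_free k c : Name k (fun _ => c) | 1.
Proof. exists (k + c); intros r Hr; rewrite Hr; reflexivity. Qed.

Instance Name_weaken k t :
  Name k t -> Name (S k) (fun r => t (fun i => r (S i))) | 2.
Proof.
  intros [i Hi]; exists (S i); intros r Hr; apply (Hi (fun i => r (S i))), Hr.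
Qed.

Section Connectives.
  Context (d : bool) (k : nat).

  Global Instance Definable_Mem s t :
    Name k s -> Name k t -> Definable d k (fun r => s r ∈ t r).
  Proof. 
    intros [i Hi] [j Hj]; exists (Mem i j); split; [constructor|].
    intros r Hr; cbn; rewrite Hi, Hj; auto.
  Qed.

  Global Instance Definable_Eq s t :
    Name k s -> Name k t -> Definable d k (fun r => s r ≐ t r).
  Proof.
    intros [i Hi] [j Hj]; exists (Eq i j); split; [constructor|].
    intros r Hr; cbn; rewrite Hi, Hj; auto.
  Qed.

  Global Instance Definable_And f g :
    Definable d k f -> Definable d k g -> Definable d k (fun r => f r ∧ g r).
  Proof.
    intros (p & Dp & Hp) (q & Dq & Hq); exists (And p q).
    split; [constructor; auto|].
    intros r Hr; cbn; rewrite Hp, Hq; auto.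
  Qed.

  Global Instance Definable_Or f g :
    Definable d k f -> Definable d k g -> Definable d k (fun r => f r ∨ g r).
  Proof.
    intros (p & Dp & Hp) (q & Dq & Hq); exists (Or p q).
    split; [constructor; auto|].
    intros r Hr; cbn; rewrite Hp, Hq; auto.
  Qed.

  Global Instance Definable_Imp f g :
    Definable d k f -> Definable d k g -> Definable d k (fun r => f r ⟶ g r).
  Proof.
    intros (p & Dp & Hp) (q & Dq & Hq); exists (Imp p q).
    split; [constructor; auto|].
    intros r Hr; cbn; rewrite Hp, Hq; auto.
  Qed.

  Global Instance Definable_Neg f :
    Definable d k f -> Definable d k (fun r => ¬ f r).
  Proof.
    intros (p & Dp & Hp); exists (Neg p).
    split; [constructor; auto|].
    intros r Hr; cbn; rewrite Hp; auto.
  Qed.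

  Global Instance Definable_Iff f g :
    Definable d k f -> Definable d k g -> Definable d k (fun r => f r ⟷ g r).
  Proof. intros; unfold pIff; typeclasses eauto. Qed.

  Lemma scons_ends_with_names x r :
    ends_with_names k r -> ends_with_names (S k) (scons x r).
  Proof. intros Hr c; apply Hr. Qed.

  Global Instance Definable_BAll t f :
    Name k t -> Definable d (S k) (fun r => f (fun i => r (S i)) (r 0)) ->
    Definable d k (fun r => ∀ x ∈ t r, f r x).
  Proof.
    intros [i Hi] (p & Dp & Hp); exists (BAll i p).
    split; [constructor; auto|].
    intros r Hr; cbn; rewrite Hi by assumption; f_equal; extensionality x.
    apply (Hp (scons x r)), scons_ends_with_names, Hr.
  Qed.

  Global Instance Definable_BEx t f :
    Name k t -> Definable d (S k) (fun r => f (fun i => r (S i)) (r 0)) ->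
    Definable d k (fun r => ∃ x ∈ t r, f r x).
  Proof.
    intros [i Hi] (p & Dp & Hp); exists (BEx i p).
    split; [constructor; auto|].
    intros r Hr; cbn; rewrite Hi by assumption; f_equal; extensionality x.
    apply (Hp (scons x r)), scons_ends_with_names, Hr.
  Qed.
End Connectives.

Instance Definable_All k f :
  Definable false (S k) (fun r => f (fun i => r (S i)) (r 0)) ->
  Definable false k (fun r => ∀ x, f r x).
Proof.
  intros (p & Dp & Hp); exists (All p).
  split; [discriminate|].
  intros r Hr; cbn; f_equal; extensionality x.
  apply (Hp (scons x r)), scons_ends_with_names, Hr.
Qed.

Instance Definable_Ex k f :
  Definable false (S k) (fun r => f (fun i => r (S i)) (r 0)) ->
  Definable false k (fun r => ∃ x, f r x).
Proof.
  intros (p & Dp & Hp); exists (Ex p).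
  split; [discriminate|].
  intros r Hr; cbn; f_equal; extensionality x.
  apply (Hp (scons x r)), scons_ends_with_names, Hr.
Qed.

(** Substituting names for the variables of a formula reduces the definability of a
    predicate at arbitrary arguments to its definability at variables. *)
Lemma Definable_subst d k n f ts :
  Definable d n f -> Forall (Name k) ts -> length ts = n ->
  Definable d k (fun r => f (fun i =>
    match nth_error ts i with Some t => t r | None => i - n end)).
Proof.
  intros (p & Dp & Hp) Hts Hn.
  assert (H : exists js, length js = n /\ forall r, ends_with_names k r ->
    map (fun t => t r) ts = map r js).
  { clear - Hts Hn; subst n; induction Hts as [|t ts [j Hj] _ (js & L & Hjs)].
    - exists []; split; reflexivity.
    - exists (j :: js); cbn; split; [congruence|].
      intros r Hr; rewrite Hj, Hjs by assumption; reflexivity. }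
  destruct H as (js & L & Hjs).
  exists (ren (fun i => match nth_error js i with
                        | Some j => j
                        | None => k + (i - n)
                        end) p).
  split; [auto using ren_Delta0|].
  intros r Hr; rewrite Hp, sem_ren.
  - f_equal; extensionality i.
    specialize (Hjs r Hr); apply (f_equal (fun l => nth_error l i)) in Hjs.
    rewrite !nth_error_map in Hjs.
    destruct (nth_error ts i), (nth_error js i); cbn in Hjs; congruence || auto.
  - intros c; rewrite (proj2 (nth_error_None _ _)); lia.
Qed.

Lemma Definable_comp1 d k (f : var -> prop) x :
  Definable d 1 (fun r => f (r 0)) ->
  Name k x -> Definable d k (fun r => f (x r)).
Proof.
  intros Hf ?; apply (Definable_subst d k 1 _ [x] Hf); auto.
Qed.

Lemma Definable_comp2 d k (f : var -> var -> prop) x y :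
  Definable d 2 (fun r => f (r 0) (r 1)) ->
  Name k x -> Name k y -> Definable d k (fun r => f (x r) (y r)).
Proof.
  intros Hf ? ?; apply (Definable_subst d k 2 _ [x; y] Hf); auto.
Qed.

Lemma Definable_comp3 d k (f : var -> var -> var -> prop) x y z :
  Definable d 3 (fun r => f (r 0) (r 1) (r 2)) ->
  Name k x -> Name k y -> Name k z ->
  Definable d k (fun r => f (x r) (y r) (z r)).
Proof.
  intros Hf ? ? ?; apply (Definable_subst d k 3 _ [x; y; z] Hf); auto.
Qed.

Lemma Definable_comp4 d k (f : var -> var -> var -> var -> prop) x y z t :
  Definable d 4 (fun r => f (r 0) (r 1) (r 2) (r 3)) ->
  Name k x -> Name k y -> Name k z -> Name k t ->
  Definable d k (fun r => f (x r) (y r) (z r) (t r)).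
Proof.
  intros Hf ? ? ? ?; apply (Definable_subst d k 4 _ [x; y; z; t] Hf); auto.
Qed.

Hint Extern 5 (Definable _ _ (fun r => ?f _)) =>
  is_var f; apply Definable_comp1 : typeclass_instances.
Hint Extern 5 (Definable _ _ (fun r => ?f _ _)) =>
  is_var f; apply Definable_comp2 : typeclass_instances.

Lemma sem_plug p xs n r :
  sem (plug p xs n) r =
  sem p (fun i => r (match nth_error xs i with
                     | Some x => index n x
                     | None => n + (i - length xs)
                     end)).
Proof. apply sem_ren. Qed.

Lemma forces_axiom p G : CZF_DCom p -> G ⊩ sem p (fun i => i).
Proof. intros Hp; apply sem_derives; rewrite ren_id; apply nd_axiom, Hp. Qed.

(* [H] forces an axiom of a scheme, and [E] says that its formula means the
   predicate in the goal: computing the meaning of [H] leaves the occurrences of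
   that formula, which [E] rewrites under the binders. *)
Ltac compute_scheme H E :=
  cbv -[plug sem scons forces pAll pEx pAnd pOr pImp pNeg pBAll pBEx pMem pEq]
    in H;
  cbn [sem scons] in H; unfold pIff;
  match type of H with forces ?p _ =>
  match goal with |- forces ?q _ => replace q with p; [exact H|] end end;
  repeat (f_equal; try (let x := fresh "x" in extensionality x));
  rewrite sem_plug; symmetry;
  match goal with |- _ = sem _ ?r => apply (E r) end;
  intros [|c]; cbn; rewrite ?Nat.sub_0_r; reflexivity.

Lemma forces_separation f :
  Definable true 1 (fun r => f (r 0)) ->
  forall G, G ⊩ ∀ a, ∃ b, ∀ x, x ∈ b ⟷ x ∈ a ∧ f x.
Proof.
  intros (p & Dp & E) G.
  assert (H := forces_axiom (separation p) G
    (or_introl (CZF_Delta0_separation p (Dp eq_refl)))).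
  compute_scheme H E.
Qed.

Lemma forces_induction f :
  Definable false 1 (fun r => f (r 0)) ->
  forall G, (G ⊩ ∀ x, (∀ y ∈ x, f y) ⟶ f x) -> forall x, G ⊩ f x.
Proof.
  intros (p & _ & E) G Hf.
  enough (H' : G ⊩ (∀ x, (∀ y ∈ x, f y) ⟶ f x) ⟶ ∀ x, f x)
    by (apply H'; [apply incl_refl | exact Hf]).
  assert (H := forces_axiom (set_induction p) G
    (or_introl (CZF_set_induction p))).
  compute_scheme H E.
Qed.

Lemma forces_collection f :
  Definable false 2 (fun r => f (r 0) (r 1)) ->
  forall G a, (G ⊩ ∀ x ∈ a, ∃ y, f x y) ->
    G ⊩ ∃ b, (∀ x ∈ a, ∃ y ∈ b, f x y) ∧ (∀ y ∈ b, ∃ x ∈ a, f x y).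
Proof.
  intros (p & _ & E) G a Ha.
  enough (H' : G ⊩ ∀ a, (∀ x ∈ a, ∃ y, f x y) ⟶
      ∃ b, (∀ x ∈ a, ∃ y ∈ b, f x y) ∧ (∀ y ∈ b, ∃ x ∈ a, f x y))
    by (apply (H' a); [apply incl_refl | exact Ha]).
  assert (H := forces_axiom (strong_collection p) G
    (or_introl (CZF_strong_collection p))).
  compute_scheme H E.
Qed.

Lemma forces_subset_collection f :
  Definable false 3 (fun r => f (r 0) (r 1) (r 2)) ->
  forall G, G ⊩ ∀ a, ∀ b, ∃ c, ∀ u, (∀ x ∈ a, ∃ y ∈ b, f x y u) ⟶
    ∃ d ∈ c, (∀ x ∈ a, ∃ y ∈ d, f x y u) ∧ (∀ y ∈ d, ∃ x ∈ a, f x y u).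
Proof.
  intros (p & _ & E) G.
  assert (H := forces_axiom (subset_collection p) G
    (or_introl (CZF_subset_collection p))).
  compute_scheme H E.
Qed.

Lemma forces_extensionality G a b :
  (G ⊩ ∀ x, x ∈ a ⟷ x ∈ b) -> (G ⊩ a ≐ b).
Proof.
  apply (forces_axiom _ G (or_introl CZF_extensionality) a b G (incl_refl G)).
Qed.

Lemma forces_pairing G : G ⊩ ∀ a, ∀ b, ∃ c, ∀ x, x ∈ c ⟷ x ≐ a ∨ x ≐ b.
Proof. exact (forces_axiom _ G (or_introl CZF_pairing)). Qed.

Lemma forces_union G : G ⊩ ∀ a, ∃ c, ∀ x, x ∈ c ⟷ ∃ y ∈ a, x ∈ y.
Proof. exact (forces_axiom _ G (or_introl CZF_union)). Qed.

Lemma forces_DCom G : G ⊩ ∀ x, ∃ y, ∀ z, ¬ ¬ (z ∈ x) ⟶ z ∈ y.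
Proof. exact (forces_axiom _ G (or_intror eq_refl)). Qed.

(** * Reasoning at a context *)

Lemma pimp_elim G p q : (G ⊩ p ⟶ q) -> (G ⊩ p) -> (G ⊩ q).
Proof. intros F Fp; exact (F G (incl_refl G) Fp). Qed.

Lemma piff1 G p q : (G ⊩ p ⟷ q) -> (G ⊩ p) -> (G ⊩ q).
Proof. intros [F _]; exact (pimp_elim _ _ _ F). Qed.

Lemma piff2 G p q : (G ⊩ p ⟷ q) -> (G ⊩ q) -> (G ⊩ p).
Proof. intros [_ F]; exact (pimp_elim _ _ _ F). Qed.

Lemma pball_elim G a f x : (G ⊩ ∀ x ∈ a, f x) -> (G ⊩ x ∈ a) -> (G ⊩ f x).
Proof. intros F; exact (pimp_elim _ _ _ (F x)). Qed.

Lemma pfalse_elim G p : (G ⊩ pFalse) -> (G ⊩ p).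
Proof.
  intros F; apply forces_local; intros C H L _.
  eapply derives_weaken; [apply F | exact L].
Qed.

Lemma por_intro1 G p q : (G ⊩ p) -> (G ⊩ p ∨ q).
Proof. intros F C H L D; apply D; eauto using incl_refl, forces_mono. Qed.

Lemma por_intro2 G p q : (G ⊩ q) -> (G ⊩ p ∨ q).
Proof. intros F C H L D; apply D; eauto using incl_refl, forces_mono. Qed.

Lemma por_elim G p q s :
  (G ⊩ p ∨ q) ->
  (forall H, incl G H -> (H ⊩ p) -> (H ⊩ s)) ->
  (forall H, incl G H -> (H ⊩ q) -> (H ⊩ s)) -> G ⊩ s.
Proof.
  intros E Dp Dq; apply forces_local; intros C H L D.
  apply E; [exact L|]; intros K L' [F|F]; apply D; eauto using incl_tran.
Qed.

Lemma pex_intro G f x : (G ⊩ f x) -> (G ⊩ ∃ x, f x).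
Proof. intros F C H L D; apply D; eauto using incl_refl, forces_mono. Qed.

Lemma pbex_intro G a f x : (G ⊩ x ∈ a) -> (G ⊩ f x) -> (G ⊩ ∃ x ∈ a, f x).
Proof. intros Fx F; apply pex_intro with x; split; assumption. Qed.

Lemma pex_elim G f s :
  (G ⊩ ∃ x, f x) -> (forall H x, incl G H -> (H ⊩ f x) -> (H ⊩ s)) -> G ⊩ s.
Proof.
  intros E Df; apply forces_local; intros C H L D.
  apply E; [exact L|]; intros K L' [x F]; apply D; eauto using incl_tran.
Qed.

Arguments pimp_elim {G p q}.
Arguments piff1 {G p q}.
Arguments piff2 {G p q}.
Arguments pball_elim {G a f} {x}.
Arguments pfalse_elim {G p}.
Arguments por_elim {G p q s}.
Arguments pex_intro {G f}.
Arguments pbex_intro {G a f}.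
Arguments pex_elim {G f s}.

(* A proof takes place at one context: [L : incl G H] moves all that is known at
   [G] to [H], which then takes the name of [G]. *)
Ltac advance L :=
  match type of L with incl ?G ?G' =>
    repeat match goal with F : forces _ G |- _ =>
      apply (fun F => forces_mono _ _ _ F L) in F end;
    clear L; clear G; rename G' into G
  end.

(* introduction of an implication or a negation *)
Tactic Notation "pintro" simple_intropattern(p) :=
  let G' := fresh "G'" in let L := fresh "L" in intros G' L p; advance L.

(* introduction of a bounded universal quantifier *)
Tactic Notation "pball" ident(x) simple_intropattern(p) :=
  intros x; pintro p.

(* [split] alone would also unfold predicates that are conjunctions. *)
Ltac psplit := repeat match goal with |- forces (pAnd _ _) _ => split end.

Tactic Notation "pex" constr(H) "as" ident(x) simple_intropattern(p) :=
  let G' := fresh "G'" in let L := fresh "L" in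
  apply (pex_elim H); try clear H; intros G' x L p; advance L.

Tactic Notation "por" constr(H)
    "as" simple_intropattern(p) "|" simple_intropattern(q) :=
  let G' := fresh "G'" in let L := fresh "L" in
  apply (por_elim H); try clear H; intros G' L; [intros p | intros q]; advance L.

Lemma peq_refl G x : G ⊩ x ≐ x.
Proof. apply nd_eqI. Qed.

Lemma peq_subst f G x y :
  Definable false 1 (fun r => f (r 0)) ->
  (G ⊩ x ≐ y) -> (G ⊩ f x) -> (G ⊩ f y).
Proof.
  intros (p & _ & Hp) E.
  assert (Hf : forall z, (G ⊩ f z) <-> derives G (inst z p)).
  { intros z; unfold inst; rewrite <- sem_derives.
    specialize (Hp (scons z (fun i => i)) (fun c => eq_refl)); cbn in Hp.
    rewrite Hp; reflexivity. }
  rewrite !Hf; apply nd_eqE, E.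
Qed.

Lemma peq_sym G x y : (G ⊩ x ≐ y) -> (G ⊩ y ≐ x).
Proof.
  intros E; apply (peq_subst (fun z => z ≐ x) G x y); [typeclasses eauto| |];
    auto using peq_refl.
Qed.

(* [E : G ⊩ x ≐ y] replaces [x] by [y] throughout *)
Ltac psubst E :=
  cbv beta in E;
  match type of E with forces (pEq ?x ?y) ?G =>
    repeat match goal with
    | F : forces ?p G |- _ =>
        tryif constr_eq F E then fail else
        match p with context [x] =>
          let q := eval pattern x in p in
          match q with ?f _ =>
            apply (peq_subst f G x y _ E) in F; cbv beta in F
          end
        end
    end;
    try match goal with
    | |- forces ?p G =>
        match p with context [x] =>
          let q := eval pattern x in p in
          match q with ?f _ =>
            apply (peq_subst f G y x _ (peq_sym _ _ _ E)); cbv beta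
          end
        end
    end;
    clear E; clear x
  end.

(** * Pairs *)

Definition Upair (z x y : var) : prop :=
  x ∈ z ∧ y ∈ z ∧ ∀ t ∈ z, t ≐ x ∨ t ≐ y.

Definition Pair (z x y : var) : prop :=
  (∃ u ∈ z, Upair u x x) ∧ (∃ v ∈ z, Upair v x y) ∧
  ∀ w ∈ z, Upair w x x ∨ Upair w x y.

Definition PairIn (x y a : var) : prop := ∃ z ∈ a, Pair z x y.

Definition Triple (t x y z : var) : prop :=
  ∃ u ∈ t, ∃ q ∈ u, Pair q x y ∧ Pair t q z.

Definition TripleIn (x y z a : var) : prop := ∃ t ∈ a, Triple t x y z.

Definition Subset (a b : var) : prop := ∀ x ∈ a, x ∈ b.

Instance Definable_Upair d k x y z :
  Name k x -> Name k y -> Name k z ->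
  Definable d k (fun r => Upair (x r) (y r) (z r)).
Proof.
  apply (Definable_comp3 _ _ Upair); unfold Upair; typeclasses eauto.
Qed.
Typeclasses Opaque Upair.

Instance Definable_Pair d k x y z :
  Name k x -> Name k y -> Name k z ->
  Definable d k (fun r => Pair (x r) (y r) (z r)).
Proof.
  apply (Definable_comp3 _ _ Pair); unfold Pair; typeclasses eauto.
Qed.
Typeclasses Opaque Pair.

Instance Definable_PairIn d k x y z :
  Name k x -> Name k y -> Name k z ->
  Definable d k (fun r => PairIn (x r) (y r) (z r)).
Proof.
  apply (Definable_comp3 _ _ PairIn); unfold PairIn; typeclasses eauto.
Qed.
Typeclasses Opaque PairIn.

Instance Definable_Triple d k x y z t :
  Name k x -> Name k y -> Name k z -> Name k t ->
  Definable d k (fun r => Triple (x r) (y r) (z r) (t r)).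
Proof.
  apply (Definable_comp4 _ _ Triple); unfold Triple; typeclasses eauto.
Qed.
Typeclasses Opaque Triple.

Instance Definable_TripleIn d k x y z t :
  Name k x -> Name k y -> Name k z -> Name k t ->
  Definable d k (fun r => TripleIn (x r) (y r) (z r) (t r)).
Proof.
  apply (Definable_comp4 _ _ TripleIn); unfold TripleIn; typeclasses eauto.
Qed.
Typeclasses Opaque TripleIn.

Lemma Upair_ex G x y : G ⊩ ∃ z, Upair z x y.
Proof.
  pex (forces_pairing G x y) as z Hz.
  apply (pex_intro z); split; [|split].
  - apply (piff2 (Hz x)), por_intro1, peq_refl.
  - apply (piff2 (Hz y)), por_intro2, peq_refl.
  - pball t Ht. exact (piff1 (Hz t) Ht).
Qed.

Lemma Upair_unique G z z' x y :
  (G ⊩ Upair z x y) -> (G ⊩ Upair z' x y) -> (G ⊩ z ≐ z').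
Proof.
  assert (S : forall z z' G, (G ⊩ Upair z x y) -> (G ⊩ Upair z' x y) ->
    G ⊩ Subset z z').
  { clear; intros z z' G (_ & _ & Hz) (Hx & Hy & _); pball t Ht.
    por (pball_elim Hz Ht) as E | E; psubst E; assumption. }
  intros H H'; apply forces_extensionality; intros t.
  split; [apply (S z z') | apply (S z' z)]; assumption.
Qed.

Lemma Pair_ex G x y : G ⊩ ∃ z, Pair z x y.
Proof.
  pex (Upair_ex G x x) as u Hu.
  pex (Upair_ex G x y) as v Hv.
  pex (Upair_ex G u v) as z (Huz & Hvz & Hz).
  apply (pex_intro z); split; [|split].
  - apply (pbex_intro u); assumption.
  - apply (pbex_intro v); assumption.
  - pball w Hw.
    por (pball_elim Hz Hw) as E | E; psubst E;
      [apply por_intro1 | apply por_intro2]; assumption.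
Qed.

Lemma Pair_unique G z z' x y :
  (G ⊩ Pair z x y) -> (G ⊩ Pair z' x y) -> (G ⊩ z ≐ z').
Proof.
  assert (S : forall z z' G, (G ⊩ Pair z x y) -> (G ⊩ Pair z' x y) ->
    G ⊩ Subset z z').
  { clear; intros z z' G (_ & _ & Hz) (Hu & Hv & _); pball t Ht.
    por (pball_elim Hz Ht) as Hut | Hvt.
    - pex Hu as u [Hu Hxu].
      assert (E := Upair_unique _ _ _ _ _ Hut Hxu); psubst E; assumption.
    - pex Hv as v [Hv Hxv].
      assert (E := Upair_unique _ _ _ _ _ Hvt Hxv); psubst E; assumption. }
  intros H H'; apply forces_extensionality; intros t.
  split; [apply (S z z') | apply (S z' z)]; assumption.
Qed.

Lemma Pair_inj1 G z x y x' y' :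
  (G ⊩ Pair z x y) -> (G ⊩ Pair z x' y') -> (G ⊩ x' ≐ x).
Proof.
  intros (Hu & _) (_ & _ & Hz).
  pex Hu as u [Huz (_ & _ & Hu)].
  por (pball_elim Hz Huz) as (Hx' & _) | (Hx' & _);
    por (pball_elim Hu Hx') as E | E; exact E.
Qed.

(** Whether [x] equals [y] cannot be decided, but [z] has elements [v = {x, y}] and
    [v' = {x, y'}], where [v] is [{x}] or [{x, y'}] and [v'] is [{x}] or [{x, y}].
    So [y] equals [x] or [y'].  If it equals [x], then all elements of [v'] equal [y]. *)
Lemma Pair_inj2 G z x y x' y' :
  (G ⊩ Pair z x y) -> (G ⊩ Pair z x' y') -> (G ⊩ y' ≐ y).
Proof.
  intros Hz Hz'; assert (E := Pair_inj1 _ _ _ _ _ _ Hz Hz'); psubst E.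
  destruct Hz as (_ & Hv & Hz), Hz' as (_ & Hv' & Hz').
  pex Hv as v [Hvz (_ & Hyv & Hv)].
  pex Hv' as v' [Hvz' (_ & Hyv' & Hv')].
  assert (K : forall G, (G ⊩ y ≐ x) -> (G ⊩ Upair v' x x ∨ Upair v' x y) ->
     (G ⊩ y' ∈ v') -> (G ⊩ y' ≐ y)).
  { clear; intros G E Hv' Hy'.
    por Hv' as (_ & _ & H) | (_ & _ & H).
    - por (pball_elim H Hy') as E' | E'; psubst E'; apply peq_sym; exact E.
    - por (pball_elim H Hy') as E' | E'; psubst E'; [|apply peq_refl].
      apply peq_sym; exact E. }
  por (pball_elim Hz' Hvz) as (_ & _ & H) | (_ & _ & H).
  - apply K; [|exact (pball_elim Hz Hvz')|exact Hyv'].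
    por (pball_elim H Hyv) as E | E; exact E.
  - por (pball_elim H Hyv) as E | E.
    + apply K; [exact E|exact (pball_elim Hz Hvz')|exact Hyv'].
    + apply peq_sym; exact E.
Qed.

(** * Constructions of sets *)

Lemma empty_ex G : G ⊩ ∃ e, ∀ x, ¬ (x ∈ e).
Proof.
  pex (forces_separation (fun x => ¬ (x ≐ x)) _ G 0) as e He.
  apply (pex_intro e); pball x Hx.
  destruct (piff1 (He x) Hx) as [_ N]; exact (pimp_elim N (peq_refl _ x)).
Qed.

Lemma singleton_ex G x : G ⊩ ∃ s, ∀ t, t ∈ s ⟷ t ≐ x.
Proof.
  pex (forces_pairing G x x) as s Hs.
  apply (pex_intro s); intros t; split; pintro H.
  - por (piff1 (Hs t) H) as E | E; exact E.
  - apply (piff2 (Hs t)), por_intro1, H.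
Qed.

Lemma adjoin_ex G a x : G ⊩ ∃ b, ∀ t, t ∈ b ⟷ t ∈ a ∨ t ≐ x.
Proof.
  pex (singleton_ex G x) as s Hs.
  pex (forces_pairing G a s) as c Hc.
  pex (forces_union G c) as b Hb.
  apply (pex_intro b); intros t; split; pintro H.
  - pex (piff1 (Hb t) H) as y [Hy Ht].
    por (piff1 (Hc y) Hy) as E | E; psubst E.
    + apply por_intro1, Ht.
    + apply por_intro2, (piff1 (Hs t) Ht).
  - apply (piff2 (Hb t)); por H as H | H.
    + apply (pbex_intro a); [|exact H].
      apply (piff2 (Hc a)), por_intro1, peq_refl.
    + apply (pbex_intro s); [|exact (piff2 (Hs t) H)].
      apply (piff2 (Hc s)), por_intro2, peq_refl.
Qed.

(** Strong Collection gathers covers of the classes [f x], for [x ∈ a], and their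
    union covers all of these classes. *)
Lemma cover_union f :
  Definable false 2 (fun r => f (r 0) (r 1)) ->
  forall G a, (G ⊩ ∀ x ∈ a, ∃ c, ∀ z, f x z ⟶ z ∈ c) ->
    G ⊩ ∃ c, ∀ x ∈ a, ∀ z, f x z ⟶ z ∈ c.
Proof.
  intros D G a H.
  pex (forces_collection (fun x c => ∀ z, f x z ⟶ z ∈ c) _ G a H) as b [Hb _].
  pex (forces_union G b) as c Hc.
  apply (pex_intro c); pball x Hx; intros z; pintro Hz.
  pex (pball_elim Hb Hx) as d [Hd Hxd].
  apply (piff2 (Hc z)), (pbex_intro d); [exact Hd | exact (pimp_elim (Hxd z) Hz)].
Qed.

Lemma union_ex f :
  Definable false 2 (fun r => f (r 0) (r 1)) ->
  forall G a, (G ⊩ ∀ x ∈ a, ∃ c, ∀ z, z ∈ c ⟷ f x z) ->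
    G ⊩ ∃ c, ∀ z, z ∈ c ⟷ ∃ x ∈ a, f x z.
Proof.
  intros D G a H.
  pex (forces_collection (fun x c => ∀ z, z ∈ c ⟷ f x z) _ G a H) as b [Hb Hb'].
  pex (forces_union G b) as c Hc.
  apply (pex_intro c); intros z; split; pintro Hz.
  - pex (piff1 (Hc z) Hz) as d [Hd Hzd].
    pex (pball_elim Hb' Hd) as x [Hx Hxd].
    apply (pbex_intro x); [exact Hx | exact (piff1 (Hxd z) Hzd)].
  - pex Hz as x [Hx Hz].
    pex (pball_elim Hb Hx) as d [Hd Hxd].
    apply (piff2 (Hc z)), (pbex_intro d); [exact Hd | exact (piff2 (Hxd z) Hz)].
Qed.

Lemma product_ex G a b :
  G ⊩ ∃ c, ∀ z, z ∈ c ⟷ ∃ x ∈ a, ∃ y ∈ b, Pair z x y.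
Proof.
  apply (union_ex (fun x z => ∃ y ∈ b, Pair z x y) _); pball x Hx.
  apply (union_ex (fun y z => Pair z x y) _); pball y Hy.
  pex (Pair_ex G x y) as p Hp.
  pex (singleton_ex G p) as c Hc.
  apply (pex_intro c); intros z; split; pintro Hz.
  - assert (E := piff1 (Hc z) Hz); psubst E; exact Hp.
  - apply (piff2 (Hc z)), (Pair_unique _ _ _ x y); assumption.
Qed.

Lemma Pair_union G z x y :
  (G ⊩ Pair z x y) -> G ⊩ ∃ v ∈ z, x ∈ v ∧ y ∈ v.
Proof.
  intros (_ & Hv & _); pex Hv as v [Hv (Hx & Hy & _)].
  apply (pbex_intro v); [exact Hv | split; assumption].
Qed.

Lemma range_ex G a : G ⊩ ∃ c, ∀ y, y ∈ c ⟷ ∃ x, PairIn x y a.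
Proof.
  pex (forces_union G a) as b Hb.
  pex (forces_union G b) as b' Hb'.
  pex (forces_separation (fun y => ∃ x ∈ b', PairIn x y a) _ G b') as c Hc.
  apply (pex_intro c); intros y; split; pintro Hy.
  - destruct (piff1 (Hc y) Hy) as [_ Hx]; pex Hx as x [_ Hx].
    exact (pex_intro x Hx).
  - apply (piff2 (Hc y)); pex Hy as x Hxy; pose proof Hxy as Hz.
    pex Hz as z [Hza Hz].
    pex (Pair_union _ _ _ _ Hz) as v [Hvz [Hxv Hyv]].
    assert (Hv : G ⊩ v ∈ b) by (apply (piff2 (Hb v)), (pbex_intro z); assumption).
    split; [|apply (pbex_intro x); [|exact Hxy]];
      apply (piff2 (Hb' _)), (pbex_intro v); assumption.
Qed.

(** If a subset [z] of [{x}] is not [{x}], then [x ∉ z], so [z] is empty: it is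
    absurd that [z] is neither, and [DCom] applies to [{∅, {x}}]. *)
Lemma cover_subsets_of_singleton G x :
  G ⊩ ∃ c, ∀ z, (∀ t ∈ z, t ≐ x) ⟶ z ∈ c.
Proof.
  pex (empty_ex G) as e He.
  pex (singleton_ex G x) as s Hs.
  pex (forces_pairing G e s) as b Hb.
  pex (forces_DCom G b) as c Hc.
  apply (pex_intro c); intros z; pintro Hz.
  apply (pimp_elim (Hc z)); pintro N.
  assert (Nx : G ⊩ ¬ (x ∈ z)).
  { pintro Hx; apply (pimp_elim N), (piff2 (Hb z)), por_intro2.
    apply forces_extensionality; intros t; split; pintro Ht.
    - exact (piff2 (Hs t) (pball_elim Hz Ht)).
    - assert (E := piff1 (Hs t) Ht); psubst E; exact Hx. }
  apply (pimp_elim N), (piff2 (Hb z)), por_intro1.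
  apply forces_extensionality; intros t; split; pintro Ht; apply pfalse_elim.
  - assert (E := pball_elim Hz Ht); psubst E; exact (pimp_elim Nx Ht).
  - exact (pimp_elim (He t) Ht).
Qed.

(** A subset [u] of [a] is the union of the sets [{x | x ∈ u}] for [x ∈ a].  These
    are subsets of singletons, so they lie in a set [b], and Subset Collection
    yields a set of families that contains the family of each [u]. *)
Lemma cover_powerset G a : G ⊩ ∃ c, ∀ u, Subset u a ⟶ u ∈ c.
Proof.
  pex (cover_union (fun x z => ∀ t ∈ z, t ≐ x) _ G a
    ltac:(pball x Hx; apply cover_subsets_of_singleton)) as b Hb.
  pex (forces_subset_collection (fun x y u => ∀ t, t ∈ y ⟷ t ≐ x ∧ x ∈ u) _
    G a b) as c Hc.
  pex (forces_collection (fun d p => ∀ x, x ∈ p ⟷ ∃ y ∈ d, x ∈ y) _ G c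
    ltac:(pball d Hd; apply (forces_union G d))) as q [Hq _].
  apply (pex_intro q); intros u; pintro Hu.
  assert (H : G ⊩ ∀ x ∈ a, ∃ y ∈ b, ∀ t, t ∈ y ⟷ t ≐ x ∧ x ∈ u).
  { pball x Hx.
    pex (singleton_ex G x) as s Hs.
    pex (forces_separation (fun _ => x ∈ u) _ G s) as y Hy.
    apply (pbex_intro y).
    - apply (pimp_elim (pball_elim Hb Hx y)); pball t Ht.
      exact (piff1 (Hs t) (proj1 (piff1 (Hy t) Ht))).
    - intros t; split.
      + pintro Ht; destruct (piff1 (Hy t) Ht) as [Hts Hxu].
        split; [exact (piff1 (Hs t) Hts) | exact Hxu].
      + pintro (E & Hxu); apply (piff2 (Hy t)).
        split; [exact (piff2 (Hs t) E) | exact Hxu]. }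
  pex (pimp_elim (Hc u) H) as d (Hd & Hd1 & Hd2).
  pex (pball_elim Hq Hd) as p [Hp Hpd].
  assert (E : G ⊩ p ≐ u).
  { apply forces_extensionality; intros t; split; pintro Ht.
    - pex (piff1 (Hpd t) Ht) as y [Hy Hty].
      pex (pball_elim Hd2 Hy) as x [Hx Hxy].
      destruct (piff1 (Hxy t) Hty) as [E Hxu]; psubst E; exact Hxu.
    - pex (pball_elim Hd1 (pball_elim Hu Ht)) as y [Hy Hty].
      apply (piff2 (Hpd t)), (pbex_intro y); [exact Hy|].
      apply (piff2 (Hty t)); split; [apply peq_refl | exact Ht]. }
  psubst E; exact Hp.
Qed.

Definition Transitive (a : var) : prop := ∀ x ∈ a, ∀ y ∈ x, y ∈ a.

Instance Definable_Transitive d k x :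
  Name k x -> Definable d k (fun r => Transitive (x r)).
Proof.
  apply (Definable_comp1 _ _ Transitive); unfold Transitive; typeclasses eauto.
Qed.
Typeclasses Opaque Transitive.

Lemma Transitive_elim G a x y :
  (G ⊩ Transitive a) -> (G ⊩ x ∈ a) -> (G ⊩ y ∈ x) -> G ⊩ y ∈ a.
Proof. intros T Hx; exact (pball_elim (pball_elim T Hx)). Qed.

Arguments Transitive_elim {G a x y}.

Lemma transitive_superset G a : G ⊩ ∃ c, a ∈ c ∧ Transitive c.
Proof.
  revert a; apply (forces_induction (fun a => ∃ c, a ∈ c ∧ Transitive c) _).
  intros a; pintro H.
  pex (forces_collection (fun x c => x ∈ c ∧ Transitive c) _ G a H) as b [Hb Hb'].
  pex (forces_union G b) as u Hu.
  pex (adjoin_ex G u a) as c Hc.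
  apply (pex_intro c); split; [apply (piff2 (Hc a)), por_intro2, peq_refl|].
  pball x Hx; pball y Hy; apply (piff2 (Hc y)), por_intro1, (piff2 (Hu y)).
  por (piff1 (Hc x) Hx) as Hxu | E.
  - pex (piff1 (Hu x) Hxu) as d [Hd Hxd].
    pex (pball_elim Hb' Hd) as x' (_ & _ & T).
    apply (pbex_intro d); [exact Hd|].
    exact (pball_elim (pball_elim T Hxd) Hy).
  - psubst E; pex (pball_elim Hb Hy) as d (Hd & Hyd & _).
    apply (pbex_intro d); assumption.
Qed.

(** In a set [a] of pairs, a second component [y] lies three levels below [a]:
    [y ∈ v ∈ z ∈ a].  ∈-induction therefore proves the claim together with its
    instances one and two levels below. *)
Lemma range_induction f :
  Definable false 1 (fun r => f (r 0)) ->
  forall G, (G ⊩ ∀ a, (∀ x, ∀ y, PairIn x y a ⟶ f y) ⟶ f a) ->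
    forall a, G ⊩ f a.
Proof.
  intros D G H.
  enough (K : forall a, G ⊩ f a ∧ ∀ z ∈ a, f z ∧ ∀ v ∈ z, f v)
    by (intros a; exact (proj1 (K a))).
  apply (forces_induction (fun a => f a ∧ ∀ z ∈ a, f z ∧ ∀ v ∈ z, f v) _).
  intros a; pintro IH; split.
  - apply (pimp_elim (H a)); intros x y; pintro Hz; pex Hz as z [Hza Hz].
    pex (Pair_union _ _ _ _ Hz) as v [Hvz [_ Hyv]].
    destruct (pball_elim IH Hza) as [_ IHz].
    exact (pball_elim (proj2 (pball_elim IHz Hvz)) Hyv).
  - pball z Hz; destruct (pball_elim IH Hz) as [Fz IHz]; split; [exact Fz|].
    pball v Hv; exact (proj1 (pball_elim IHz Hv)).
Qed.

Lemma Pair_inj G z x y x' y' :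
  (G ⊩ Pair z x y) -> (G ⊩ Pair z x' y') -> (G ⊩ x' ≐ x) /\ (G ⊩ y' ≐ y).
Proof.
  intros H H'; split; [exact (Pair_inj1 _ _ _ _ _ _ H H')
                      |exact (Pair_inj2 _ _ _ _ _ _ H H')].
Qed.

Lemma Triple_ex G x y z : G ⊩ ∃ t, Triple t x y z.
Proof.
  pex (Pair_ex G x y) as q Hq.
  pex (Pair_ex G q z) as t Ht; apply (pex_intro t).
  pex (Pair_union _ _ _ _ Ht) as u [Hu [Hqu _]].
  apply (pbex_intro u); [exact Hu|].
  apply (pbex_intro q); [exact Hqu | split; assumption].
Qed.

Lemma Triple_inj G t x y z x' y' z' :
  (G ⊩ Triple t x y z) -> (G ⊩ Triple t x' y' z') ->
  G ⊩ x' ≐ x ∧ y' ≐ y ∧ z' ≐ z.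
Proof.
  intros H H'.
  pex H as u [_ H]; pex H as q [_ [Hq Hz]].
  pex H' as u' [_ H']; pex H' as q' [_ [Hq' Hz']].
  destruct (Pair_inj _ _ _ _ _ _ Hz Hz') as [E Ez]; psubst E.
  destruct (Pair_inj _ _ _ _ _ _ Hq Hq') as [Ex Ey].
  split; [|split]; assumption.
Qed.

Definition Ord (a : var) : prop := Transitive a ∧ ∀ x ∈ a, Transitive x.

Instance Definable_Ord d k x :
  Name k x -> Definable d k (fun r => Ord (x r)).
Proof. apply (Definable_comp1 _ _ Ord); unfold Ord; typeclasses eauto. Qed.
Typeclasses Opaque Ord.

Lemma Ord_elem G a x : (G ⊩ Ord a) -> (G ⊩ x ∈ a) -> (G ⊩ Ord x).
Proof.
  intros [T Tx] Hx; split; [exact (pball_elim Tx Hx)|].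
  pball y Hy; exact (pball_elim Tx (pball_elim (pball_elim T Hx) Hy)).
Qed.

Lemma Ord_union G a b :
  (G ⊩ ∀ x ∈ a, Ord x) -> (G ⊩ ∀ y, y ∈ b ⟷ ∃ x ∈ a, y ∈ x) -> (G ⊩ Ord b).
Proof.
  intros Ha Hb; split; pball x Hx; pex (piff1 (Hb x) Hx) as z [Hz Hxz].
  - pball y Hy; apply (piff2 (Hb y)), (pbex_intro z); [exact Hz|].
    exact (pball_elim (pball_elim (proj1 (pball_elim Ha Hz)) Hxz) Hy).
  - exact (pball_elim (proj2 (pball_elim Ha Hz)) Hxz).
Qed.

Lemma Ord_succ G a b :
  (G ⊩ Ord a) -> (G ⊩ ∀ x, x ∈ b ⟷ x ∈ a ∨ x ≐ a) -> (G ⊩ Ord b).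
Proof.
  intros [T Ta] Hb; split; pball x Hx.
  - pball y Hy; apply (piff2 (Hb y)), por_intro1.
    por (piff1 (Hb x) Hx) as Hxa | E; [exact (pball_elim (pball_elim T Hxa) Hy)|].
    psubst E; exact Hy.
  - por (piff1 (Hb x) Hx) as Hxa | E; [exact (pball_elim Ta Hxa)|].
    psubst E; exact T.
Qed.

(** * The realizability universe *)

Section Universe.
  Context (P : pca_vars).
  Local Notation A := (carrier P).

  Definition AppEq (x y z : var) : prop := TripleIn x y z (appl P).

  Definition AppSat (x y : var) (p : var -> prop) : prop :=
    ∃ z ∈ A, AppEq x y z ∧ p z.

  Definition StageClosed (W : var) : prop :=
    ∀ y, ∀ b, PairIn y b W ⟶
      ∃ c ∈ b, ∀ z ∈ y, ∃ f ∈ A, ∃ u, Pair z f u ∧ PairIn u c W.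

  Definition InStage (x a : var) : prop := ∃ W, PairIn x a W ∧ StageClosed W.

  Definition InVA (x : var) : prop := ∃ a, Ord a ∧ InStage x a.

  Definition MemClause (req : var -> var -> var -> prop) (e a b : var) : prop :=
    ∃ c, AppSat (pr0 P) e (fun e0 => PairIn e0 c b) ∧
         AppSat (pr1 P) e (fun e1 => req e1 a c).

  Definition EqClause (req : var -> var -> var -> prop) (e a b : var) : prop :=
    ∀ f, ∀ d,
      (PairIn f d a ⟶
         AppSat (pr0 P) e (fun e0 => AppSat e0 f (fun g =>
           MemClause req g d b))) ∧
      (PairIn f d b ⟶
         AppSat (pr1 P) e (fun e1 => AppSat e1 f (fun g =>
           MemClause req g d a))).

  Definition EqClosed (R : var) : prop :=
    ∀ e, ∀ a, ∀ b, TripleIn e a b R ⟶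
      EqClause (fun x y z => TripleIn x y z R) e a b.

  Definition RealizesEq (e a b : var) : prop :=
    ∃ R, TripleIn e a b R ∧ EqClosed R.

  Definition RealizesMem (e a b : var) : prop := MemClause RealizesEq e a b.

  Global Instance Definable_StageClosed k x :
    Name k x -> Definable false k (fun r => StageClosed (x r)).
  Proof.
    apply (Definable_comp1 _ _ StageClosed); unfold StageClosed.
    typeclasses eauto.
  Qed.

  Global Instance Definable_InVA k x :
    Name k x -> Definable false k (fun r => InVA (x r)).
  Proof.
    apply (Definable_comp1 _ _ InVA); unfold InVA, InStage, StageClosed.
    typeclasses eauto.
  Qed.

  Global Instance Definable_RealizesEq k x y z :
    Name k x -> Name k y -> Name k z ->
    Definable false k (fun r => RealizesEq (x r) (y r) (z r)).
  Proof.
    apply (Definable_comp3 _ _ RealizesEq).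
    unfold RealizesEq, EqClosed, EqClause, MemClause, AppSat, AppEq.
    typeclasses eauto.
  Qed.

  Typeclasses Opaque StageClosed InVA RealizesEq.

  Lemma InVA_elim G x :
    (G ⊩ InVA x) -> G ⊩ ∀ z ∈ x, ∃ f ∈ A, ∃ u, Pair z f u ∧ InVA u.
  Proof.
    intros H; pex H as a [Ha H]; pex H as W [Hx HW].
    pex (pimp_elim (HW x a) Hx) as c [Hc Hxc].
    pball z Hz; pex (pball_elim Hxc Hz) as f [Hf H]; pex H as u [Hzu Hu].
    apply (pbex_intro f); [exact Hf|].
    apply (pex_intro u); split; [exact Hzu|].
    apply (pex_intro c); split; [exact (Ord_elem _ _ _ Ha Hc)|].
    apply (pex_intro W); split; assumption.
  Qed.

  Lemma PairIn_mono G x y a b :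
    (G ⊩ PairIn x y a) -> (G ⊩ Subset a b) -> (G ⊩ PairIn x y b).
  Proof.
    intros H S; pex H as z [Hz H].
    apply (pbex_intro z); [exact (pball_elim S Hz) | exact H].
  Qed.

  (** The derivations of the elements of [x] lie in stages with different
      indices [α].  Adding all pairs [<u, γ>], with [γ] the union of these
      indices, brings the elements into one stage, as the definition of a stage
      demands. *)
  Lemma InVA_intro G x :
    (G ⊩ ∀ z ∈ x, ∃ f ∈ A, ∃ u, Pair z f u ∧ InVA u) -> G ⊩ InVA x.
  Proof.
    intros H.
    pex (forces_collection (fun z W => ∃ f ∈ A, ∃ u, ∃ a, Pair z f u ∧ Ord a ∧
      PairIn u a W ∧ StageClosed W) _ G x
      ltac:(pball z Hz; pex (pball_elim H Hz) as f [Hf H']; pex H' as u [Hzu H'];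
        pex H' as a [Ha H']; pex H' as W [Hu HW];
        apply (pex_intro W), (pbex_intro f); [exact Hf|];
        apply (pex_intro u), (pex_intro a); psplit; assumption))
      as B [HB HB'].
    pex (forces_union G B) as W0 HW0.
    assert (C0 : G ⊩ StageClosed W0).
    { intros y b; pintro Hy; pex Hy as t [Ht Hy].
      pex (piff1 (HW0 t) Ht) as W [HWB HtW].
      pex (pball_elim HB' HWB) as z' [_ H']; pex H' as f' [_ H'].
      pex H' as u' H'; pex H' as a' (_ & _ & _ & HW).
      pex (pimp_elim (HW y b) (pbex_intro t HtW Hy)) as c [Hc Hyc].
      apply (pbex_intro c); [exact Hc|].
      pball z Hz; pex (pball_elim Hyc Hz) as f [Hf H1]; pex H1 as u [Hzu Hu].
      apply (pbex_intro f); [exact Hf|].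
      apply (pex_intro u); split; [exact Hzu|].
      apply (PairIn_mono _ _ _ W); [exact Hu|].
      pball s Hs; exact (piff2 (HW0 s) (pbex_intro W HWB Hs)). }
    assert (H0 : G ⊩ ∀ z ∈ x, ∃ a, ∃ f ∈ A, ∃ u,
      Pair z f u ∧ Ord a ∧ PairIn u a W0).
    { pball z Hz; pex (pball_elim HB Hz) as W [HW H']; pex H' as f [Hf H'].
      pex H' as u H'; pex H' as a (Hzu & Ha & Hu & _).
      apply (pex_intro a), (pbex_intro f); [exact Hf|].
      apply (pex_intro u); split; [exact Hzu | split; [exact Ha|]].
      apply (PairIn_mono _ _ _ W); [exact Hu|].
      pball s Hs; exact (piff2 (HW0 s) (pbex_intro W HW Hs)). }
    pex (forces_collection (fun z a => ∃ f ∈ A, ∃ u,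
      Pair z f u ∧ Ord a ∧ PairIn u a W0) _ G x H0) as O [HO HO'].
    pex (forces_union G O) as c Hc.
    assert (Oc : G ⊩ Ord c).
    { apply (Ord_union _ O); [|exact Hc].
      pball a Ha; pex (pball_elim HO' Ha) as z [_ H']; pex H' as f [_ H'].
      pex H' as u (_ & Oa & _); exact Oa. }
    pex (adjoin_ex G c c) as c' Hc'.
    pex (range_ex G x) as D HD.
    pex (singleton_ex G c) as s Hs.
    pex (product_ex G D s) as E HE.
    pex (forces_pairing G W0 E) as p Hp.
    pex (forces_union G p) as W1 HW1.
    pex (Pair_ex G x c') as q Hq.
    pex (adjoin_ex G W1 q) as W HW.
    assert (HW0W : G ⊩ Subset W0 W).
    { pball t Ht; apply (piff2 (HW t)), por_intro1, (piff2 (HW1 t)).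
      apply (pbex_intro W0); [|exact Ht].
      apply (piff2 (Hp W0)), por_intro1, peq_refl. }
    assert (HEW : G ⊩ Subset E W).
    { pball t Ht; apply (piff2 (HW t)), por_intro1, (piff2 (HW1 t)).
      apply (pbex_intro E); [|exact Ht].
      apply (piff2 (Hp E)), por_intro2, peq_refl. }
    apply (pex_intro c'); split; [exact (Ord_succ _ _ _ Oc Hc')|].
    apply (pex_intro W); split.
    { apply (pbex_intro q); [|exact Hq].
      apply (piff2 (HW q)), por_intro2, peq_refl. }
    intros y b; pintro Hy; pex Hy as t [Ht Hy].
    por (piff1 (HW t) Ht) as Ht1 | Et; [pex (piff1 (HW1 t) Ht1) as w [Hw Htw];
      por (piff1 (Hp w) Hw) as Ew | Ew; psubst Ew|].
    - pex (pimp_elim (C0 y b) (pbex_intro t Htw Hy)) as d [Hd Hyd].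
      apply (pbex_intro d); [exact Hd|].
      pball z Hz; pex (pball_elim Hyd Hz) as f [Hf H']; pex H' as u [Hzu Hu].
      apply (pbex_intro f); [exact Hf|].
      apply (pex_intro u); split; [exact Hzu|].
      exact (PairIn_mono _ _ _ _ _ Hu HW0W).
    - pex (piff1 (HE t) Htw) as y' [Hy' H']; pex H' as c1 [Hc1 Hy1].
      assert (Ec := piff1 (Hs c1) Hc1); psubst Ec.
      destruct (Pair_inj _ _ _ _ _ _ Hy Hy1) as [E1 E2]; psubst E1; psubst E2.
      pex (piff1 (HD y) Hy') as f0 H'; pex H' as z0 [Hz0 Hzf0].
      pex (pball_elim HO Hz0) as a [Ha H']; pex H' as f1 [_ H'].
      pex H' as u1 (Hzu1 & _ & Hu1).
      destruct (Pair_inj _ _ _ _ _ _ Hzf0 Hzu1) as [_ E2]; psubst E2.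
      pex (pimp_elim (C0 y a) Hu1) as d [Hd Hyd].
      apply (pbex_intro d); [exact (piff2 (Hc d) (pbex_intro a Ha Hd))|].
      pball z Hz; pex (pball_elim Hyd Hz) as f [Hf H']; pex H' as u [Hzu Hu].
      apply (pbex_intro f); [exact Hf|].
      apply (pex_intro u); split; [exact Hzu|].
      exact (PairIn_mono _ _ _ _ _ Hu HW0W).
    - psubst Et.
      destruct (Pair_inj _ _ _ _ _ _ Hq Hy) as [E1 E2]; psubst E1; psubst E2.
      apply (pbex_intro c); [apply (piff2 (Hc' c)), por_intro2, peq_refl|].
      pball z Hz; pex (pball_elim H Hz) as f [Hf H']; pex H' as u [Hzu _].
      apply (pbex_intro f); [exact Hf|].
      apply (pex_intro u); split; [exact Hzu|].
      pex (Pair_ex G u c) as t Htuc.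
      apply (pbex_intro t); [|exact Htuc].
      apply (pball_elim HEW), (piff2 (HE t)), (pbex_intro u).
      + apply (piff2 (HD u)), (pex_intro f), (pbex_intro z); assumption.
      + apply (pbex_intro c); [apply (piff2 (Hs c)), peq_refl | exact Htuc].
  Qed.

  (** Membership in the universe is not a bounded condition.  It suffices that
      [{t | t = z ∧ InVA t}] is a set for each [z], since the union of these sets
      over [z ∈ a] is the set sought.  This follows by induction: [z] is in the
      universe exactly if its elements are pairs with first component in [A] and
      second component in the set of those [u] that occur in [z] and are in the
      universe, and this condition is bounded. *)
  Lemma VA_separation G a : G ⊩ ∃ b, ∀ z, z ∈ b ⟷ z ∈ a ∧ InVA z.
  Proof.
    assert (S : forall G a, (G ⊩ ∀ z ∈ a, ∃ b, ∀ t, t ∈ b ⟷ t ≐ z ∧ InVA z) ->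
      G ⊩ ∃ b, ∀ z, z ∈ b ⟷ z ∈ a ∧ InVA z).
    { clear; intros G a H.
      pex (union_ex (fun z t => t ≐ z ∧ InVA z) _ G a H) as b Hb.
      apply (pex_intro b); intros z; split; pintro Hz.
      - pex (piff1 (Hb z) Hz) as z' [Hz' [E Vz]]; psubst E; split; assumption.
      - destruct Hz as [Hz Vz]; apply (piff2 (Hb z)), (pbex_intro z); [exact Hz|].
        split; [apply peq_refl | exact Vz]. }
    apply S; pball z Hz; clear Hz a; revert z.
    apply (range_induction (fun z => ∃ b, ∀ t, t ∈ b ⟷ t ≐ z ∧ InVA z) _).
    intros z; pintro IH.
    pex (range_ex G z) as D HD.
    pex (S G D ltac:(pball u Hu; pex (piff1 (HD u) Hu) as f Hf;
      exact (pimp_elim (IH f u) Hf))) as V HV.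
    pex (singleton_ex G z) as s Hs.
    pex (forces_separation (fun t => ∀ y ∈ t, ∃ f ∈ A, ∃ u ∈ V, Pair y f u) _ G s)
      as b Hb.
    apply (pex_intro b); intros t; split; pintro Ht.
    - destruct (piff1 (Hb t) Ht) as [Hts H].
      assert (E := piff1 (Hs t) Hts); psubst E.
      split; [apply peq_refl|]; apply InVA_intro.
      pball y Hy; pex (pball_elim H Hy) as f [Hf H']; pex H' as u [Hu Hyu].
      apply (pbex_intro f); [exact Hf|]; apply (pex_intro u).
      split; [exact Hyu | exact (proj2 (piff1 (HV u) Hu))].
    - destruct Ht as [E Vz]; psubst E.
      apply (piff2 (Hb z)); split; [apply (piff2 (Hs z)), peq_refl|].
      pball y Hy; pex (pball_elim (InVA_elim _ _ Vz) Hy) as f [Hf H'].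
      pex H' as u [Hyu Vu].
      apply (pbex_intro f); [exact Hf|]; apply (pbex_intro u); [|exact Hyu].
      apply (piff2 (HV u)); split; [|exact Vu].
      apply (piff2 (HD u)), (pex_intro f), (pbex_intro y); assumption.
  Qed.

  Lemma RealizesEq_elim G e z c g u :
    (G ⊩ RealizesEq e z c) -> (G ⊩ PairIn g u z) ->
    G ⊩ ∃ h, ∃ c', PairIn h c' c ∧ ∃ e', RealizesEq e' u c'.
  Proof.
    intros H Hu; pex H as R [He HR].
    pex (pimp_elim (proj1 (pimp_elim (HR e z c) He g u)) Hu) as e0 [_ [_ H]].
    pex H as h [_ [_ H]]; pex H as c' [H1 H2].
    pex H1 as h0 [_ [_ Hc']]; pex H2 as e' [_ [_ He']].
    apply (pex_intro h0), (pex_intro c'); split; [exact Hc'|].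
    apply (pex_intro e'), (pex_intro R); split; assumption.
  Qed.

  (** By induction on [c]: a [z] realizably equal to [c] consists of pairs
      [<g, u>] with [u] realizably equal to some [c'] in the range of [c], so it
      is a subset of the product of [A] and a set that covers these [u]. *)
  Lemma cover_realizably_equal G c :
    G ⊩ ∃ Y, ∀ z, InVA z ∧ (∃ e, RealizesEq e z c) ⟶ z ∈ Y.
  Proof.
    revert c; apply (range_induction
      (fun c => ∃ Y, ∀ z, InVA z ∧ (∃ e, RealizesEq e z c) ⟶ z ∈ Y) _).
    intros c; pintro IH.
    pex (range_ex G c) as D HD.
    pex (cover_union (fun c z => InVA z ∧ ∃ e, RealizesEq e z c) _ G D
      ltac:(pball u Hu; pex (piff1 (HD u) Hu) as f Hf;
            exact (pimp_elim (IH f u) Hf))) as U HU.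
    pex (product_ex G A U) as AU HAU.
    pex (cover_powerset G AU) as Y HY.
    apply (pex_intro Y); intros z; pintro (Vz & H); pex H as e He.
    apply (pimp_elim (HY z)); pball y Hy.
    pex (pball_elim (InVA_elim _ _ Vz) Hy) as g [Hg H].
    pex H as u [Hyu Vu].
    pex (RealizesEq_elim _ _ _ _ _ _ He (pbex_intro y Hy Hyu)) as h H.
    pex H as c' [Hc' H].
    apply (piff2 (HAU y)), (pbex_intro g); [exact Hg|].
    apply (pbex_intro u); [|exact Hyu].
    apply (pimp_elim (pball_elim HU (piff2 (HD c') (pex_intro h Hc')) u)).
    split; assumption.
  Qed.

  (** [i = p u u] with [u f = p f i]: the fixed-point equation of a realizer of
      [z = z] that is the same for all [z]. *)
  Definition Reflexive (i : var) : prop :=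
    ∃ u ∈ A, AppEq (pr0 P) i u ∧ AppEq (pr1 P) i u ∧
      ∀ f ∈ A, AppSat u f (fun g => AppEq (pr0 P) g f ∧ AppEq (pr1 P) g i).

  (** The triples [<<i, w>, w>], for [w] in a transitive set that contains [z], are
      closed under the clause for equality: for [<f, d> ∈ w], both components of
      [i] send [f] to [p f i], which realizes [d ∈ w] relative to the triples.  The application of [i] to [f] is defined only for [f]
      in the pca, so [w] is restricted to the universe. *)
  Lemma Reflexive_realizes G i z :
    (G ⊩ i ∈ A) -> (G ⊩ Reflexive i) -> (G ⊩ InVA z) -> G ⊩ RealizesEq i z z.
  Proof.
    intros Hi H Vz; pex H as u (Hu & Hi0 & Hi1 & Huf).
    pex (transitive_superset G z) as T [Hz TT].
    pex (VA_separation G T) as V HV.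
    pex (forces_collection (fun w t => Triple t i w w) _ G V
      ltac:(pball w Hw; apply Triple_ex)) as R [HR HR'].
    apply (pex_intro R); split.
    { exact (pball_elim HR (piff2 (HV z) (conj Hz Vz))). }
    intros e a b; pintro Ht; pex Ht as t [Ht Hab].
    pex (pball_elim HR' Ht) as w [Hw Htw].
    destruct (Triple_inj _ _ _ _ _ _ _ _ Hab Htw) as (E1 & E2 & E3).
    psubst E1; psubst E2; psubst E3.
    destruct (piff1 (HV b) Hw) as [Hb Vb].
    assert (K : G ⊩ ∀ f, ∀ d, PairIn f d b ⟶
      AppSat u f (fun g => MemClause (fun x y z => TripleIn x y z R) g d b)).
    { intros f d; pintro Hd.
      pose proof Hd as H; pex H as y [Hy Hyd].
      pex (pball_elim (InVA_elim _ _ Vb) Hy) as f' [Hf H]; pex H as d' [Hyd' Vd].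
      destruct (Pair_inj _ _ _ _ _ _ Hyd' Hyd) as [E1 E2]; psubst E1; psubst E2.
      pex (pball_elim Huf Hf) as g (Hg & Hfg & Hg0 & Hg1).
      apply (pbex_intro g); [exact Hg|]; split; [exact Hfg|].
      apply (pex_intro d'); split.
      - apply (pbex_intro f'); [exact Hf|]; split; assumption.
      - apply (pbex_intro e); [exact Hi|]; split; [exact Hg1|].
        pex (Pair_union _ _ _ _ Hyd) as v [Hvy [_ Hdv]].
        assert (Hd' := Transitive_elim TT
          (Transitive_elim TT (Transitive_elim TT Hb Hy) Hvy) Hdv).
        exact (pball_elim HR (piff2 (HV d') (conj Hd' Vd))). }
    intros f d; split; pintro Hd; apply (pbex_intro u); try exact Hu;
      split; try assumption; exact (pimp_elim (K f d) Hd).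
  Qed.

  (** ** Combinators *)

  Global Instance Definable_AppEq d k x y z :
    Name k x -> Name k y -> Name k z ->
    Definable d k (fun r => AppEq (x r) (y r) (z r)).
  Proof.
    apply (Definable_comp3 _ _ AppEq); unfold AppEq; typeclasses eauto.
  Qed.

  Definition IsFunctional : prop :=
    ∀ x ∈ A, ∀ y ∈ A, ∀ z ∈ A, ∀ w ∈ A,
      AppEq x y z ∧ AppEq x y w ⟶ z ≐ w.

  Definition IsK (k : var) : prop :=
    ∀ x ∈ A, ∀ y ∈ A, AppSat k x (fun kx => AppEq kx y x).

  Definition App2 (x y z w : var) : prop :=
    AppSat x z (fun xz => AppSat y z (fun yz => AppEq xz yz w)).

  Definition IsS (s : var) : prop :=
    ∀ x ∈ A, ∀ y ∈ A,
      AppSat s x (fun sx => AppSat sx y (fun sxy =>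
        ∀ z ∈ A, ∀ w ∈ A, AppEq sxy z w ⟷ App2 x y z w)).

  Definition IsPairing : prop :=
    pr P ∈ A ∧ pr0 P ∈ A ∧ pr1 P ∈ A ∧
    ∀ x ∈ A, ∀ y ∈ A,
      AppSat (pr P) x (fun px => AppSat px y (fun pxy =>
        AppEq (pr0 P) pxy x ∧ AppEq (pr1 P) pxy y)).

  Definition PcaLaws : prop :=
    IsFunctional ∧ (∃ k ∈ A, IsK k) ∧ (∃ s ∈ A, IsS s) ∧ IsPairing.

  Lemma functional G x y z w :
    (G ⊩ PcaLaws) -> (G ⊩ x ∈ A) -> (G ⊩ y ∈ A) -> (G ⊩ z ∈ A) -> (G ⊩ w ∈ A) ->
    (G ⊩ AppEq x y z) -> (G ⊩ AppEq x y w) -> G ⊩ z ≐ w.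
  Proof.
    intros [F _] Hx Hy Hz Hw Ez Ew.
    exact (pimp_elim (pball_elim (pball_elim (pball_elim (pball_elim F Hx) Hy) Hz) Hw)
      (conj Ez Ew)).
  Qed.

  Lemma IsK_elim G k x :
    (G ⊩ PcaLaws) -> (G ⊩ k ∈ A) -> (G ⊩ IsK k) -> (G ⊩ x ∈ A) ->
    G ⊩ ∃ c ∈ A, AppEq k x c ∧ ∀ y ∈ A, ∀ z ∈ A, AppEq c y z ⟷ z ≐ x.
  Proof.
    intros HP Hk K Hx.
    pex (pball_elim (pball_elim K Hx) Hx) as c (Hc & Hkc & _).
    apply (pbex_intro c); [exact Hc|]; split; [exact Hkc|].
    pball y Hy.
    pex (pball_elim (pball_elim K Hx) Hy) as c' (Hc' & Hkc' & Hcy).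
    assert (E := functional _ _ _ _ _ HP Hk Hx Hc' Hc Hkc' Hkc); psubst E.
    pball z Hz; split; pintro E.
    - exact (functional _ _ _ _ _ HP Hc Hy Hz Hx E Hcy).
    - psubst E; exact Hcy.
  Qed.

  (** [Represents d F]: for each [x], the element [d x] is a code of the partial
      function [f ↦ z] with graph [F x f z].  Graphs make application terms
      available without names for their values, and the closure properties below
      are the cases of combinatory completeness for terms in two variables. *)
  Definition Represents (d : var) (F : var -> var -> var -> prop) : prop :=
    ∀ x ∈ A, ∃ c ∈ A, AppEq d x c ∧
      ∀ f ∈ A, ∀ z ∈ A, AppEq c f z ⟷ F x f z.

  Definition Representable (F : var -> var -> var -> prop) : prop :=
    ∃ d ∈ A, Represents d F.

  Lemma Representable_first G :
    (G ⊩ PcaLaws) -> G ⊩ Representable (fun x f z => z ≐ x).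
  Proof.
    intros HP; pose proof HP as (_ & HK & _); pex HK as k [Hk K].
    apply (pbex_intro k); [exact Hk|].
    pball x Hx; exact (IsK_elim _ _ _ HP Hk K Hx).
  Qed.

  (** [d] is [k i], for any code [i] of the function. *)
  Lemma Representable_constant G (F : var -> var -> prop) i :
    (G ⊩ PcaLaws) -> (G ⊩ i ∈ A) ->
    (G ⊩ ∀ f ∈ A, ∀ z ∈ A, AppEq i f z ⟷ F f z) ->
    G ⊩ Representable (fun _ f z => F f z).
  Proof.
    intros HP Hi HF; pose proof HP as (_ & HK & _); pex HK as k [Hk K].
    pex (IsK_elim _ _ _ HP Hk K Hi) as d (Hd & _ & Hdi).
    apply (pbex_intro d); [exact Hd|].
    pball x Hx; apply (pbex_intro i); [exact Hi|]; split; [|exact HF].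
    exact (piff2 (pball_elim (pball_elim Hdi Hx) Hi) (peq_refl _ i)).
  Qed.

  Lemma Representable_element G a :
    (G ⊩ PcaLaws) -> (G ⊩ a ∈ A) -> G ⊩ Representable (fun x f z => z ≐ a).
  Proof.
    intros HP Ha; pose proof HP as (_ & HK & _); pex HK as k [Hk K].
    pex (IsK_elim _ _ _ HP Hk K Ha) as c (Hc & _ & Hca).
    exact (Representable_constant _ (fun f z => z ≐ a) _ HP Hc Hca).
  Qed.

  Lemma Representable_second G :
    (G ⊩ PcaLaws) -> G ⊩ Representable (fun x f z => z ≐ f).
  Proof.
    intros HP; pose proof HP as (_ & HK & HS & _).
    pex HK as k [Hk K]; pex HS as s [Hs S].
    pex (pball_elim (pball_elim S Hk) Hk) as sk (_ & _ & H).
    pex H as i (Hi & _ & Hskk).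
    assert (Hif : G ⊩ ∀ f ∈ A, AppEq i f f).
    { pball f Hf; apply (piff2 (pball_elim (pball_elim Hskk Hf) Hf)).
      pex (IsK_elim _ _ _ HP Hk K Hf) as c (Hc & Hkc & Hcf).
      apply (pbex_intro c); [exact Hc|]; split; [exact Hkc|].
      apply (pbex_intro c); [exact Hc|]; split; [exact Hkc|].
      exact (piff2 (pball_elim (pball_elim Hcf Hc) Hf) (peq_refl _ f)). }
    apply (Representable_constant _ (fun f z => z ≐ f) i HP Hi).
    pball f Hf; pball z Hz; split; pintro E.
    - exact (functional _ _ _ _ _ HP Hi Hf Hz Hf E (pball_elim Hif Hf)).
    - psubst E; exact (pball_elim Hif Hf).
  Qed.

  Definition AppGraph (F F' : var -> var -> var -> prop) (x f z : var) : prop :=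
    ∃ a ∈ A, F x f a ∧ ∃ b ∈ A, F' x f b ∧ AppEq a b z.

  (** If [d] and [d'] represent [F] and [F'], then [s (s (k s) d) d'], which maps
      [x] to [s (d x) (d' x)], represents the application of [F] to [F']. *)
  Lemma Representable_app G F F' :
    (G ⊩ PcaLaws) -> (G ⊩ Representable F) -> (G ⊩ Representable F') ->
    G ⊩ Representable (AppGraph F F').
  Proof.
    intros HP HF HF'; pose proof HP as (_ & HK & HS & _).
    pex HK as k [Hk K]; pex HS as s [Hs S].
    pex HF as d [Hd HF]; pex HF' as d' [Hd' HF'].
    pex (IsK_elim _ _ _ HP Hk K Hs) as ks (Hks & _ & Hkss).
    pex (pball_elim (pball_elim S Hks) Hd) as sks (_ & _ & H).
    pex H as c1 (Hc1 & _ & Hc1d).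
    pex (pball_elim (pball_elim S Hc1) Hd') as sc1 (_ & _ & H).
    pex H as c2 (Hc2 & _ & Hc2d).
    apply (pbex_intro c2); [exact Hc2|]; pball x Hx.
    pex (pball_elim HF Hx) as m (Hm & Hdm & HmF).
    pex (pball_elim HF' Hx) as m' (Hm' & Hdm' & HmF').
    pex (pball_elim (pball_elim S Hm) Hm') as sm (Hsm & Hsmm & H).
    pex H as n (Hn & Hnn & Hnm).
    apply (pbex_intro n); [exact Hn|]; split.
    - apply (piff2 (pball_elim (pball_elim Hc2d Hx) Hn)).
      apply (pbex_intro sm); [exact Hsm|]; split.
      + apply (piff2 (pball_elim (pball_elim Hc1d Hx) Hsm)).
        apply (pbex_intro s); [exact Hs|]; split.
        * exact (piff2 (pball_elim (pball_elim Hkss Hx) Hs) (peq_refl _ s)).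
        * apply (pbex_intro m); [exact Hm | split; assumption].
      + apply (pbex_intro m'); [exact Hm' | split; assumption].
    - pball f Hf; pball z Hz; split; pintro H.
      + pose proof (piff1 (pball_elim (pball_elim Hnm Hf) Hz) H) as H'.
        pex H' as a (Ha & Hma & H'); pex H' as b (Hb & Hmb & Hab).
        apply (pbex_intro a); [exact Ha|]; split.
        { exact (piff1 (pball_elim (pball_elim HmF Hf) Ha) Hma). }
        apply (pbex_intro b); [exact Hb|]; split; [|exact Hab].
        exact (piff1 (pball_elim (pball_elim HmF' Hf) Hb) Hmb).
      + apply (piff2 (pball_elim (pball_elim Hnm Hf) Hz)).
        pex H as a (Ha & Hma & H); pex H as b (Hb & Hmb & Hab).
        apply (pbex_intro a); [exact Ha|]; split.
        { exact (piff2 (pball_elim (pball_elim HmF Hf) Ha) Hma). }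
        apply (pbex_intro b); [exact Hb|]; split; [|exact Hab].
        exact (piff2 (pball_elim (pball_elim HmF' Hf) Hb) Hmb).
  Qed.

  (** With [v x f = p f (p (x x) (x x))], the element [u = v v] satisfies
      [u f = p f (p u u)]. *)
  Lemma Reflexive_ex G : (G ⊩ PcaLaws) -> G ⊩ ∃ i ∈ A, Reflexive i.
  Proof.
    intros HP; pose proof HP as (_ & _ & _ & Hp & _ & _ & Hpair).
    pose (cp := fun _ _ z : var => z ≐ pr P).
    pose (self := AppGraph (fun x f z => z ≐ x) (fun x f z => z ≐ x)).
    assert (Hcp : G ⊩ Representable cp) by
      exact (Representable_element _ _ HP Hp).
    assert (Hself : G ⊩ Representable self) by
      exact (Representable_app _ _ _ HP (Representable_first _ HP)
               (Representable_first _ HP)).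
    assert (HF := Representable_app _ _ _ HP
      (Representable_app _ _ _ HP Hcp (Representable_second _ HP))
      (Representable_app _ _ _ HP (Representable_app _ _ _ HP Hcp Hself) Hself)).
    clear Hcp Hself; pex HF as v [Hv HF].
    pex (pball_elim HF Hv) as u (Hu & Hvu & HuF).
    pex (pball_elim (pball_elim Hpair Hu) Hu) as pu (Hpu & Epu & H).
    pex H as i (Hi & Ei & Hi0 & Hi1).
    apply (pbex_intro i); [exact Hi|]; apply (pbex_intro u); [exact Hu|].
    split; [exact Hi0|]; split; [exact Hi1|]; pball f Hf.
    pex (pball_elim (pball_elim Hpair Hf) Hi) as pf (Hpf & Epf & H).
    pex H as g (Hg & Eg & Hg0 & Hg1).
    apply (pbex_intro g); [exact Hg|]; split; [|split; assumption].
    apply (piff2 (pball_elim (pball_elim HuF Hf) Hg)).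
    assert (Hself : G ⊩ self v f u).
    { apply (pbex_intro v); [exact Hv|]; split; [apply peq_refl|].
      apply (pbex_intro v); [exact Hv|]; split; [apply peq_refl | exact Hvu]. }
    apply (pbex_intro pf); [exact Hpf|]; split.
    - apply (pbex_intro (pr P)); [exact Hp|]; split; [apply peq_refl|].
      apply (pbex_intro f); [exact Hf|]; split; [apply peq_refl | exact Epf].
    - apply (pbex_intro i); [exact Hi|]; split; [|exact Eg].
      apply (pbex_intro pu); [exact Hpu|]; split.
      + apply (pbex_intro (pr P)); [exact Hp|]; split; [apply peq_refl|].
        apply (pbex_intro u); [exact Hu|]; split; [exact Hself | exact Epu].
      + apply (pbex_intro u); [exact Hu|]; split; [exact Hself | exact Ei].
  Qed.

  Definition RealizesDCom (e : var) : prop :=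
    ∀ x, InVA x ⟶ ∃ y, InVA y ∧ ∀ z, InVA z ⟶
      ∀ f ∈ A, ¬ (∃ g ∈ A, ¬ ∃ h ∈ A, RealizesMem h z x) ⟶
        AppSat e f (fun g => RealizesMem g z y).

  (** The sets that are realizably equal to an element of [x] are covered by a
      set [U], and [DCom] covers by a set those [z] for which this holds up to a
      double negation. *)
  Lemma cover_not_not_elements G x :
    G ⊩ ∃ Y, ∀ z,
      InVA z ∧ ¬ ¬ (∃ h ∈ A, RealizesMem h z x) ⟶ z ∈ Y.
  Proof.
    pex (range_ex G x) as D HD.
    pex (cover_union (fun c z => InVA z ∧ ∃ e, RealizesEq e z c) _ G D
      ltac:(pball c Hc; apply cover_realizably_equal)) as U HU.
    pex (forces_DCom G U) as Y HY.
    apply (pex_intro Y); intros z; pintro (Vz & N).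
    apply (pimp_elim (HY z)); pintro NU; apply (pimp_elim N); pintro H.
    apply (pimp_elim NU).
    pex H as h [Hh H]; pex H as c [H1 H2].
    pex H1 as f [Hf [_ Hfc]]; pex H2 as e [He [_ Hez]].
    apply (pimp_elim (pball_elim HU (piff2 (HD c) (pex_intro f Hfc)) z)).
    split; [exact Vz | exact (pex_intro e Hez)].
  Qed.

  (** The realizer is the constant function with value [p 0 i], and the witness for
      [x] is [{<0, z> | z ∈ V}], where [V] is the part in the universe of a cover
      of the [z] that are not absurdly elements of [x]. *)
  Lemma DCom_realized G :
    (G ⊩ PcaLaws) -> (G ⊩ num0 P ∈ A) -> G ⊩ ∃ e ∈ A, RealizesDCom e.
  Proof.
    intros HP Hn; pose proof HP as (_ & HK & _ & Hp & _ & _ & Hpair).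
    pex (Reflexive_ex _ HP) as i [Hi Ri].
    pex HK as k [Hk K].
    pex (pball_elim (pball_elim Hpair Hn) Hi) as pn (_ & _ & H).
    pex H as q (Hq & _ & Hq0 & Hq1).
    pex (IsK_elim _ _ _ HP Hk K Hq) as e (He & _ & Heq).
    apply (pbex_intro e); [exact He|]; intros x; pintro Vx.
    pex (cover_not_not_elements G x) as Y HY.
    pex (VA_separation G Y) as V HV.
    pex (singleton_ex G (num0 P)) as s Hs.
    pex (product_ex G s V) as y Hy.
    apply (pex_intro y); split.
    { apply InVA_intro; pball t Ht.
      pex (piff1 (Hy t) Ht) as f [Hf H]; pex H as z [Hz Htz].
      assert (E := piff1 (Hs f) Hf); psubst E.
      apply (pbex_intro (num0 P)); [exact Hn|]; apply (pex_intro z).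
      split; [exact Htz | exact (proj2 (piff1 (HV z) Hz))]. }
    intros z; pintro Vz; pball f Hf; pintro N.
    apply (pbex_intro q); [exact Hq|]; split.
    { exact (piff2 (pball_elim (pball_elim Heq Hf) Hq) (peq_refl _ q)). }
    apply (pex_intro z); split.
    - apply (pbex_intro (num0 P)); [exact Hn|]; split; [exact Hq0|].
      pex (Pair_ex G (num0 P) z) as t Ht.
      apply (pbex_intro t); [|exact Ht].
      apply (piff2 (Hy t)), (pbex_intro (num0 P));
        [apply (piff2 (Hs _)), peq_refl|].
      apply (pbex_intro z); [|exact Ht].
      apply (piff2 (HV z)); split; [|exact Vz].
      apply (pimp_elim (HY z)); split; [exact Vz|].
      (* A negation that holds is realized by every element, for instance [f]. *)
      pintro N'; exact (pimp_elim N (pbex_intro f Hf N')).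
    - apply (pbex_intro i); [exact Hi|]; split; [exact Hq1|].
      exact (Reflexive_realizes _ _ _ Hi Ri Vz).
  Qed.
End Universe.

(* Conversion then unfolds named predicates down to the connectives before it
   unfolds the connectives, on which both sides agree. *)
Strategy 1000 [forces derivable local pMem pEq pAnd pOr pImp pFalse pAll pEx pNeg
  pIff pBAll pBEx].

(** By computation, the meaning of the realizability formula is the proposition
    [∃ e ∈ A, RealizesDCom e]. *)
Lemma CZF_DCom_every_pca_models : proves CZF_DCom (every_pca_models DCom).
Proof.
  unfold proves; rewrite <- (ren_id (every_pca_models DCom)).
  apply sem_derives; intros A ap pair fst snd n0 n1 G _ HP.
  destruct HP as ((_ & HF) & HK & HS & HPr & Hn & _).
  exact (DCom_realized (PcaVars A ap pair fst snd n0 n1) G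
    (conj HF (conj HK (conj HS HPr))) Hn).
Qed.

Theorem theorem7p3 :
  proves (theory_union CZF (theory_union (axiom DCom) Sigma_Sep))
         (every_pca_models DCom) /\
  proves (theory_union CZF (theory_union (axiom DCom) (axiom REA)))
         (every_pca_models DCom).
Proof.
  split; (eapply nd_weaken;
    [|exact CZF_DCom_every_pca_models|apply incl_refl]);
    intros p [H|H]; [left | right; left | left | right; left]; exact H.
Qed.
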